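(* Let $\mu$ be a probability measure on $\mathbb{C}$ and let $\{u_n\}_{n\ge1}$ be a $\mu$-distributed and log-Cesàro bounded sequence of complex numbers. Let $\{v_n\}_{n\ge1}$ be the sequence such that $v_n=u_n+\sigma_nX_n$, where the $X_n$ are i.i.d. random variables satisfying $X_n\stackrel{d}{=}-X_n$ and $\mathbb{E}[|X_n|]<\infty$, and $\sigma_n\downarrow0$, $\sigma_n\neq0$. Define the polynomial $P_n(z):=(z-v_1)(z-v_2)\cdots(z-v_n)$. Then $\mathscr{M}(P_n)\xrightarrow{w}\mu$ almost surely and $\mathscr{M}(P_n')\xrightarrow{w}\mu$ in probability, as $n\to\infty$.
   Context: The $X_n$ are complex-valued and the $\sigma_n$ are real numbers. For a nonconstant complex polynomial $P$, $\mathscr{M}(P)$ denotes the uniform probability measure on the multiset of zeros of $P$ (zeros counted with multiplicity); $P'$ is the derivative ($n\ge 2$ when $P_n'$ is considered). A sequence of probability measures $\mu_n$ on $\mathbb{C}$ converges weakly to a probability measure $\mu$ (written $\mu_n\xrightarrow{w}\mu$) if $\int f\,d\mu_n\to\int f\,d\mu$ for every $f\in C_c^\infty(\mathbb{C})$. For random probability measures $\mu_n$: $\mu_n\xrightarrow{w}\mu$ in probability means $\lim_{n\to\infty}\mathbb{P}(\mu_n\in N)=1$ for every neighbourhood $N$ of $\mu$ in the weak topology; $\mu_n\xrightarrow{w}\mu$ almost surely means that with probability one $\mu_n\to\mu$ weakly. A sequence $\{a_n\}_{n\ge1}$ of complex numbers is $\mu$-distributed if $\frac1n\sum_{i=1}^n\delta_{a_i}\xrightarrow{w}\mu$,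 where $\delta_a$ is the Dirac measure at $a$. It is log-Cesàro bounded if the sequence $\left\{\frac1n\sum_{i=1}^n\log_+|a_i|\right\}_{n\ge1}$ is bounded, where $\log_+x=\max(\log x,0)$ (with $\log_+0=0$). $\stackrel{d}{=}$ denotes equality in distribution, and $\sigma_n\downarrow0$ means that $\sigma_n$ is non-increasing with limit $0$.
   Formalization: The X_n are additionally assumed not to be almost surely 0; otherwise the claim on M(P_n') fails, e.g. X_n = 0 and u_n the van der Corput sequence on the unit circle, where P_n(z) = z^n - 1 for n = 2^k. *)

(* Defs.v *)
From HB Require Import structures.
From mathcomp Require Import all_boot all_order all_algebra finmap.
From mathcomp Require Import all_classical all_reals all_analysis.
From mathcomp Require Import complex.
Set Implicit Arguments.
Unset Strict Implicit.
Unset Printing Implicit Defensive.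
Import Order.TTheory GRing.Theory Num.Theory.
Import numFieldNormedType.Exports.
Local Open Scope classical_set_scope.
Local Open Scope ring_scope.
Local Open Scope complex_scope.

(* The norm [`|z|] of [R[i]] is itself an element of [R[i]]; [normc z] is the
   modulus as an element of [R]. *)
Notation normc := ComplexField.Normc.normc.

Section complex_plane.
Context (R : realType).

Definition plane_of_complex (z : R[i]) : R * R := (complex.Re z, complex.Im z).

(* The sigma-algebra on [R[i]] is the Borel sigma-algebra of [R * R] read
   through the bijection [plane_of_complex]. *)
HB.instance Definition _ := isPointed.Build R[i] 0.
HB.instance Definition _ :=
  Measurable.copy R[i] (g_sigma_algebra_preimageType plane_of_complex).

Lemma measurable_complexE (A : set R[i]) :
  measurable A <-> measurable [set p : R * R | A (p.1 +i* p.2)].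
Proof.
split=> [[B mB <-]|mA].
  rewrite setTI (_ : [set p | _] = B) //.
  by apply/seteqP; split=> -[].
exists [set p : R * R | A (p.1 +i* p.2)] => //.
by rewrite setTI; apply/seteqP; split=> -[].
Qed.

Fixpoint continuously_differentiable (k : nat) (g : R * R -> R) : Prop :=
  if k is k'.+1 then
    [/\ forall p, derivable g p (1, 0),
        forall p, derivable g p (0, 1),
        continuously_differentiable k' (fun p => 'D_(1, 0) g p) &
        continuously_differentiable k' (fun p => 'D_(0, 1) g p)]
  else continuous g.

(* Smoothness is in the real sense, as a function on the plane. Real-valued
   test functions suffice, integration being linear. *)
Definition Cc_infty (f : R[i] -> R) : Prop :=
  let g := fun p : R * R => f (p.1 +i* p.2) in
  (forall k, continuously_differentiable k g) /\
  compact (closure [set p | g p != 0]).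

End complex_plane.

Section weak_convergence.
Context (R : realType).

Definition weakly_cvg (mu_ : nat -> probability R[i] R)
    (mu : probability R[i] R) : Prop :=
  forall f : R[i] -> R, Cc_infty f ->
    \int[mu_ n]_z (f z) @[n --> \oo] --> \int[mu]_z (f z).

Definition test_integrals (mu : probability R[i] R) :
    {ptws {f : R[i] -> R | Cc_infty f} -> R} :=
  fun f => \int[mu]_z (sval f z).

(* The probability measures on [R[i]] with the coarsest topology making
   mu |-> \int f dmu continuous for every test function f. *)
Definition weak_probability : Type := initial_topology test_integrals.
HB.instance Definition _ := Topological.on weak_probability.

Lemma weakly_cvgE (mu_ : nat -> probability R[i] R)
    (mu : probability R[i] R) :
  weakly_cvg mu_ mu <->
  (mu_ : nat -> weak_probability) @ \oo --> (mu : weak_probability).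
Proof.
split=> [cvmu A [_ [[B Bop <-] Bmu] BA]|cvmu f Cf].
  have cv : (test_integrals \o mu_) n @[n --> \oo] --> test_integrals mu.
    apply/cvg_sup => f C [_ [[D Dop <-] Df] DC].
    apply: filterS DC _.
    by apply: (cvmu (sval f) (svalP f)); exact: open_nbhs_nbhs.
  by apply: filterS BA _; apply: cv; exact: open_nbhs_nbhs.
have ctf : continuous (fun nu : weak_probability => \int[nu]_z (f z)).
  move=> nu; apply: (@continuous_comp weak_probability
    {ptws {f : R[i] -> R | Cc_infty f} -> R} R test_integrals
    (fun g => g (exist _ f Cf))).
    exact: initial_continuous.
  move: (test_integrals nu) => g A Ag.
  have /cvg_sup/(_ (exist _ f Cf)) : nbhs g --> g by exact: cvg_id.
  by apply; exact: initial_continuous.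
exact: (cvg_comp _ _ cvmu (ctf _)).
Qed.

(* Supremum over the measurable subsets of [E], so that the probability of
   {mu_n \in N} makes sense for every neighbourhood [N]; it is [P E] when [E]
   is measurable. *)
Definition inner_probability d (T : measurableType d) (P : probability T R)
    (E : set T) : \bar R :=
  ereal_sup [set P A | A in [set A | measurable A /\ A `<=` E]].

Lemma inner_probabilityE d (T : measurableType d) (P : probability T R)
    (E : set T) :
  measurable E -> inner_probability P E = P E.
Proof.
move=> mE; apply/eqP; rewrite eq_le; apply/andP; split.
  by apply: ge_ereal_sup => _ [A [mA AE] <-]; rewrite le_measure ?inE.
by apply: ereal_sup_ubound; exists E => //; split.
Qed.

Definition weakly_cvg_in_probability d (T : measurableType d)
    (P : probability T R) (mu_ : nat -> T -> probability R[i] R)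
    (mu : probability R[i] R) : Prop :=
  forall N : set weak_probability, nbhs (mu : weak_probability) N ->
    inner_probability P [set w | N (mu_ n w)] @[n --> \oo] --> 1%E.

Definition weakly_cvg_almost_surely d (T : measurableType d)
    (P : probability T R) (mu_ : nat -> T -> probability R[i] R)
    (mu : probability R[i] R) : Prop :=
  {ae P, forall w, weakly_cvg (mu_ ^~ w) mu}.

End weak_convergence.

Section zeros.
Context (R : realType).

(* Uniform probability measure on the entries of [s], with repetitions; the
   junk value at [::] is the Dirac measure at 0. *)
Definition uniform_on (s : seq R[i]) : probability R[i] R :=
  mnormalize (msum (fun k => \d_(nth 0 s k)) (size s)) \d_(0 : R[i]).

Lemma uniform_onE (s : seq R[i]) (A : set R[i]) : s != [::] ->
  uniform_on s A = ((size s)%:R^-1%:E * \sum_(a <- s) \d_a A)%E.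
Proof.
move=> s0; have s_gt0 : (0 < size s)%N by case: s s0.
rewrite /uniform_on /= /mnormalize /= /msum.
have sE : (\sum_(k < size s) \d_(nth 0%R s k) [set: R[i]] = (size s)%:R%:E :> \bar R)%E.
  under eq_bigr do rewrite diracT.
  by rewrite sumEFin sumr_const card_ord.
rewrite sE.
rewrite eqe pnatr_eq0 -[size s == 0%N]negbK -lt0n s_gt0 /= muleC; congr (_ * _)%E.
by rewrite (big_nth 0) big_mkord.
Qed.

Definition zeros (p : {poly R[i]}) : seq R[i] :=
  sval (closed_field_poly_normal p).

Lemma zerosE (p : {poly R[i]}) :
  p = lead_coef p *: \prod_(z <- zeros p) ('X - z%:P).
Proof. exact: svalP (closed_field_poly_normal p). Qed.

Definition zero_measure (p : {poly R[i]}) : probability R[i] R :=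
  uniform_on (zeros p).

(* Sequences are indexed from 0: [a k] is the (k+1)-st term. *)
Definition distributed_as (mu : probability R[i] R) (a : nat -> R[i]) : Prop :=
  weakly_cvg (fun n => uniform_on (mkseq a n)) mu.

(* [ln 0 = 0], whence log_+ 0 = 0. *)
Definition log_plus (x : R) : R := Num.max (ln x) 0.

Definition log_cesaro_bounded (a : nat -> R[i]) : Prop :=
  exists M : R, forall n : nat,
    (0 < n)%N -> n%:R^-1 * (\sum_(i < n) log_plus (normc (a i))) <= M.

End zeros.

Section random_variables.
Context d d' (T : measurableType d) (T' : measurableType d') (R : realType).
Variable P : probability T R.

Definition mutually_independent (I : choiceType) (X : I -> T -> T') : Prop :=
  forall (J : {fset I}) (A : I -> set T'), (forall j, measurable (A j)) ->
    P (\bigcap_(j in [set` J]) X j @^-1` A j) =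
    (\prod_(j <- J) P (X j @^-1` A j))%E.

Definition eq_distribution (X Y : T -> T') : Prop :=
  forall A, measurable A -> P (X @^-1` A) = P (Y @^-1` A).

End random_variables.

(* Main.v *)
(** With [L_n = P_n' / P_n = \sum_k 1 / (z - v_k)], Jensen's formula on the
circle of center [c] and radius [r] says that the sums of [log_+ (|z - c| / r)]
over the zeros of [P_n'] and over the zeros of [P_n] differ by the circle mean
of [log |L_n|], up to O(log n). The circle mean is replaced by the mean over the
[N]-th roots [zeta] of a point [w] of the unit circle, for which the formula is
the factorization [\prod_zeta (zeta - b) = +- (w - b ^ N)]; among O(n) candidates
for [w], most keep [log |w - b ^ N|] bounded on average over the zeros, and this
error is divided by [N]. At the corresponding points [|L_n|] is at most
polynomial in [n]. It is not small either, with high probability: replacing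
[X_k] by [- X_k] moves a term of [L_n] by an amount bounded below for [k < m],
so that a Littlewood-Offord estimate over the first [m] terms applies, uniformly
in [z]. Differences of two functions [log_+ (|z - c| / r)] are bumps whose linear
combinations are dense in the compactly supported continuous functions, hence
[M(P_n')] and [M(P_n)] have the same limit in probability.

For [M(P_n)] itself, if [P (|X_0| > M) <= 4 ^ -a] then a proportion [1 / a] of the
[X_k], [k < n], exceeds [M] with probability at most [2 ^ -n], by a union bound;
Borel-Cantelli and uniform continuity of the test function conclude. *)

Require Import Defs.
From HB Require Import structures.
From mathcomp Require Import all_boot all_order all_algebra finmap.
From mathcomp Require Import all_classical all_reals all_analysis.
From mathcomp Require Import measurable_realfun complex.
From mathcomp Require Import ring lra zify.
Set Implicit Arguments.
Unset Strict Implicit.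
Unset Printing Implicit Defensive.
Import Order.TTheory GRing.Theory Num.Theory.
Import numFieldNormedType.Exports.
Local Open Scope classical_set_scope.
Local Open Scope ring_scope.
Local Open Scope complex_scope.

(** Sums over zeros are needed only up to o(n), but [ln |L_n|] may be very negative at exceptional
    points of the circle, and a true circle mean would require integrating these singularities. With
    [N] points, [N] fixed before [n], it suffices that [|L_n| >= delta] at each of them, and a union
    bound gives this once each point fails with probability at most [eta / (2 N)]. The price is an
    error linear in [n], but divided by [N]. The point [w] must stay away from the [N]-th powers of
    the rescaled zeros and critical points, which are random, so it cannot be fixed beforehand.
    Hence the deterministic family of candidates: Markov's inequality keeps at least half of them
    usable with high probability, and a usable one that avoids the powers is then picked for each
    outcome. Since [ln delta] only has to be o(n), [delta] may depend on the first [m] values of [u]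
    and [sigma], with [m] fixed. This gets around [sigma k] tending to 0, which leaves no lower
    bound uniform in [k] for the effect of a sign change. *)

Lemma big_mkseq (A T : Type) (idx : A) (op : A -> A -> A) (f : nat -> T) (n : nat)
    (F : T -> A) :
  \big[op/idx]_(x <- mkseq f n) F x = \big[op/idx]_(k < n) F (f k).
Proof.
by rewrite big_map -[iota 0 n](_ : index_iota 0 n = _) ?big_mkord// /index_iota subn0.
Qed.

(** * The complex plane *)

Section modulus.
Context (R : realType).
Implicit Types z w : R[i].

Lemma normc_sqrtE z : normc z = Num.sqrt (complex.Re z ^+ 2 + complex.Im z ^+ 2).
Proof. by case: z. Qed.

Lemma normc_ge0 z : 0 <= normc z.
Proof. by rewrite normc_sqrtE sqrtr_ge0. Qed.

Lemma normc0 : normc (0 : R[i]) = 0.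
Proof. by rewrite normc_sqrtE /= expr0n /= addr0 sqrtr0. Qed.

Lemma normc1 : normc (1 : R[i]) = 1.
Proof. exact: ComplexField.Normc.normc1. Qed.

Lemma normc_eq0 z : (normc z == 0) = (z == 0).
Proof.
apply/eqP/eqP => [/ComplexField.Normc.eq0_normc //|->]; exact: normc0.
Qed.

Lemma normc_gt0 z : (0 < normc z) = (z != 0).
Proof. by rewrite lt_neqAle normc_ge0 andbT eq_sym normc_eq0. Qed.

Lemma normcM z w : normc (z * w) = normc z * normc w.
Proof. exact: ComplexField.Normc.normcM. Qed.

Lemma normcV z : normc z^-1 = (normc z)^-1.
Proof. exact: ComplexField.Normc.normcV. Qed.

Lemma normcX z n : normc (z ^+ n) = normc z ^+ n.
Proof.
by elim: n => [|n IH]; rewrite ?expr0 ?normc1 // !exprS normcM IH.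
Qed.

Lemma normc_prod I (s : seq I) (F : I -> R[i]) :
  normc (\prod_(i <- s) F i) = \prod_(i <- s) normc (F i).
Proof. exact: (big_morph _ normcM normc1). Qed.

Lemma normcB z w : normc (z - w) = normc (w - z).
Proof. by rewrite -opprB normcN. Qed.

Lemma normc_le_sum I (s : seq I) (F : I -> R[i]) :
  normc (\sum_(i <- s) F i) <= \sum_(i <- s) normc (F i).
Proof.
elim/big_ind2: _ => [|x a y b xa yb|//]; first by rewrite normc0.
by rewrite (le_trans (le_normcD _ _)) ?lerD.
Qed.

Lemma normc_real (x : R) : normc x%:C = `|x|.
Proof. by rewrite normc_sqrtE /= expr0n addr0 sqrtr_sqr. Qed.

Lemma normc_nat n : normc (n%:R : R[i]) = n%:R.
Proof. by rewrite -(rmorph_nat (real_complex R)) normc_real normr_nat. Qed.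

Lemma Re_le_normc z : `|complex.Re z| <= normc z.
Proof. by rewrite normc_sqrtE -sqrtr_sqr ler_wsqrtr// lerDl sqr_ge0. Qed.

Lemma Im_le_normc z : `|complex.Im z| <= normc z.
Proof. by rewrite normc_sqrtE -sqrtr_sqr ler_wsqrtr// lerDr sqr_ge0. Qed.

Lemma normc_le_ReIm z : normc z <= `|complex.Re z| + `|complex.Im z|.
Proof.
rewrite normc_sqrtE -[leRHS]ger0_norm ?addr_ge0// -sqrtr_sqr ler_wsqrtr//.
by rewrite sqrrD !real_normK ?num_real// lerD2r lerDl mulrn_wge0 ?mulr_ge0.
Qed.

Lemma ler_normc_dist z w : `|normc z - normc w| <= normc (z - w).
Proof.
have tri x y : normc x <= normc y + normc (x - y).
  by rewrite -{1}(subrK y x) addrC le_normcD.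
rewrite ler_norml ; apply/andP; split.
  by rewrite lerBrDr addrC lerBlDr normcB tri.
by rewrite lerBlDr addrC tri.
Qed.

End modulus.

Section logarithms.
Context (R : realType).
Implicit Types x y : R.

Lemma ln_le x y : 0 < x -> x <= y -> ln x <= ln y.
Proof.
by move=> x0 xy; rewrite ler_ln ?posrE// (lt_le_trans x0).
Qed.

Lemma ln_prod (I : eqType) (s : seq I) (F : I -> R) :
  (forall i, i \in s -> 0 < F i) ->
  ln (\prod_(i <- s) F i) = \sum_(i <- s) ln (F i).
Proof.
elim: s => [|i s IH] F0; first by rewrite !big_nil ln1.
have Fs j : j \in s -> 0 < F j by move=> js; rewrite F0// inE js orbT.
rewrite !big_cons lnM ?posrE ?IH// ?F0 ?mem_head//.
by rewrite big_seq; apply: prodr_gt0.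
Qed.

(** The sum is the logarithm of [x ^ n / n!], a term of the exponential series of [x]. *)
Lemma sum_ln_inv_le x n : 0 < x ->
  \sum_(0 <= j < n) ln (x / j.+1%:R) <= x.
Proof.
move=> x0; case: n => [|n]; first by rewrite big_nil ltW.
rewrite -ln_prod => [|j _]; last by rewrite divr_gt0.
rewrite big_split/= prodrV => [|i _]; last by rewrite unitfE.
rewrite prodr_const_nat subn0.
rewrite -[leRHS]expRK ln_le//.
  apply: divr_gt0; first by rewrite exprn_gt0.
  by apply: prodr_gt0 => i _; rewrite ltr0n.
apply: le_trans (expR_ge1Dxn n (ltW x0)).
rewrite -[_ / _]add0r lerD//.
by rewrite fact_prod natr_prod big_add1.
Qed.

(** Each value of [|l - m|] is taken at most twice. *)
Lemma sum_distn_le (g : nat -> R) n m : (m < n)%N ->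
  (forall j, 0 <= g j) ->
  \sum_(l < n) g `|l - m|%N <= 2 * \sum_(0 <= j < n) g j.
Proof.
move=> mn g0; rewrite -(big_mkord xpredT (fun l => g `|l - m|%N)).
have mn' := ltnW mn.
rewrite (big_cat_nat (n := m)) //= mulr_natl mulr2n addrC.
apply: lerD.
  rewrite -[m in X in X <= _]add0n big_addn.
  rewrite [leRHS](big_cat_nat (n := (n - m)%N)) ?leq_subr//=.
  rewrite (eq_bigr g) => [|i _]; last by rewrite distnEl ?leq_addl// addnK.
  by rewrite lerDl sumr_ge0.
rewrite big_nat_rev/= add0n.
rewrite [leRHS](big_cat_nat (n := m.+1))//= big_nat_recl//.
rewrite [leLHS](_ : _ = \sum_(0 <= i < m) g i.+1); last first.
  apply: eq_big_nat => i /andP[_ im]; congr g.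
  by rewrite distnEr ?leq_subr// subKn.
by rewrite addrAC; apply: ler_wpDl => //; rewrite addr_ge0// sumr_ge0.
Qed.

End logarithms.

(** * Roots of unimodular numbers and candidate points on the unit circle *)

Section unit_circle.
Context (R : realType).

(** The point of argument [2 arctan t], written rationally; [t] in [[0, 1]] describes a quarter of
    the circle. *)
Definition cayley (t : R) : R[i] := (1 +i* t) / (1 +i* - t).

Let cayley_den (t : R) : (1 +i* t) != 0.
Proof. by rewrite eq_complex/= oner_eq0. Qed.

Lemma normc_cayley t : normc (cayley t) = 1.
Proof.
rewrite /cayley normcM normcV !normc_sqrtE/= sqrrN divff//.
by rewrite sqrtr_eq0 -ltNge ltr_wpDr ?sqr_ge0// expr1n.
Qed.

(** The difference is [2 i (s - t) / ((1 - i s) (1 - i t))], and both factors of the denominator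
    have modulus at most the square root of 2. *)
Lemma cayley_dist s t : 0 <= s <= 1 -> 0 <= t <= 1 ->
  `|s - t| <= normc (cayley s - cayley t).
Proof.
move=> /andP[s0 s1] /andP[t0 t1].
have -> : cayley s - cayley t =
    (0 +i* (2 * (s - t))) / ((1 +i* - s) * (1 +i* - t)).
  rewrite /cayley -mulNr addf_div ?cayley_den//; congr (_ / _).
  by apply/eqP; rewrite eq_complex/=; apply/andP; split; apply/eqP; ring.
have n2 (u : R) : 0 <= u <= 1 -> normc (1 +i* - u) <= Num.sqrt 2.
  move=> /andP[u0 u1]; rewrite normc_sqrtE/= ler_wsqrtr// sqrrN expr1n.
  by rewrite -[leRHS]/(1 + 1) lerD2l expr_le1.
have num : normc (0 +i* (2 * (s - t))) = 2 * `|s - t|.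
  by rewrite normc_sqrtE/= expr0n/= add0r sqrtr_sqr normrM ger0_norm.
rewrite normcM normcV normcM num.
rewrite ler_pdivlMr ?mulr_gt0 ?normc_gt0 ?cayley_den// mulrC.
rewrite ler_wpM2r// -[leRHS](@sqr_sqrtr _ 2)// expr2.
by rewrite ler_pM ?normc_ge0// n2 ?s0 ?t0.
Qed.

Lemma unity_roots_seq (N : nat) (w : R[i]) : (0 < N)%N -> normc w = 1 ->
  exists rs : seq R[i], [/\ size rs = N,
    forall z, z \in rs -> z ^+ N = w,
    forall z, z \in rs -> normc z = 1 &
    forall a, \prod_(z <- rs) normc (z - a) = normc (w - a ^+ N)].
Proof.
move=> N0 w1; have [rs prs] := closed_field_poly_normal ('X^N - w%:P).
have mon : 'X^N - w%:P \is monic by exact: monicXnsubC.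
move: prs; rewrite (monicP mon) scale1r => prs.
have rsw z : z \in rs -> z ^+ N = w.
  move=> zrs; have : root ('X^N - w%:P) z by rewrite prs root_prod_XsubC.
  by rewrite rootE !hornerE subr_eq0 => /eqP.
exists rs; split=> //.
- have : size ('X^N - w%:P) = N.+1 by rewrite size_XnsubC.
  by rewrite prs size_prod_XsubC => -[].
- move=> z /rsw zw; apply/eqP; rewrite -(@pexpr_eq1 _ _ N)// ?normc_ge0//.
  by rewrite -normcX zw w1.
- move=> a; have := congr1 (fun p : {poly R[i]} => normc p.[a]) prs.
  rewrite horner_prod normc_prod !hornerE normcB => ->.
  by apply: eq_bigr => z _; rewrite !hornerE normcB.
Qed.

(* [ln `|w - b| = ln_+ `|b| + ln (dist_ratio w b)] *)
Definition dist_ratio (w b : R[i]) : R := normc (w - b) / Num.max 1 (normc b).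

Lemma dist_ratio_le2 w b : normc w = 1 -> dist_ratio w b <= 2.
Proof.
move=> w1; rewrite /dist_ratio ler_pdivrMr ?lt_max ?ltr01//.
rewrite (le_trans (le_normcD _ _))// normcN w1 mulr2n mulrDl !mul1r.
by rewrite lerD// le_max lexx ?orbT.
Qed.

(** If [|b| <= 2] the denominator is at most 2; otherwise [|w - b| >= |b| - 1 >= |b| / 2]. *)
Lemma dist_ratio_ge w b : normc w = 1 ->
  Num.min 1 (normc (w - b)) / 2 <= dist_ratio w b.
Proof.
move=> w1; rewrite /dist_ratio ler_pdivlMr ?lt_max ?ltr01// mulrAC.
rewrite ler_pdivrMr//.
have [b2|b2] := leP (normc b) 2.
  rewrite ler_pM ?le_min ?ler01 ?normc_ge0 ?le_max ?ler01//.
    by rewrite ge_min lexx orbT.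
  by rewrite ge_max b2 ler1n.
have wb : normc b - 1 <= normc (w - b).
  by rewrite -w1 normcB (le_trans (ler_norm _))// ler_normc_dist.
rewrite (@le_trans _ _ (normc b))//.
  rewrite -[leRHS]mul1r ler_pM ?le_min ?ler01 ?normc_ge0 ?le_max ?ler01//.
    by rewrite ge_min lexx.
  by rewrite ge_max lexx andbT; lra.
lra.
Qed.

Lemma abs_ln_dist_ratio w b : normc w = 1 -> w != b ->
  `|ln (dist_ratio w b)| <= ln 2 - ln (Num.min 1 (normc (w - b))).
Proof.
move=> w1 wb.
have m0 : 0 < Num.min 1 (normc (w - b)).
  by rewrite lt_min ltr01 normc_gt0 subr_eq0.
have k0 : 0 < dist_ratio w b.
  by rewrite (lt_le_trans _ (dist_ratio_ge _ w1))// divr_gt0.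
rewrite ler_norml; apply/andP; split; last first.
  rewrite (@le_trans _ _ (ln 2))// ?ln_le ?dist_ratio_le2//.
  by rewrite lerDl oppr_ge0 ln_le0// ge_min lexx.
rewrite opprB -ln_div ?posrE// ln_le ?dist_ratio_ge// divr_gt0//.
Qed.

Definition circle_pt (T l : nat) : R[i] := cayley (l%:R / T%:R).

Lemma normc_circle_pt T l : normc (circle_pt T l) = 1.
Proof. exact: normc_cayley. Qed.

Lemma circle_pt_dist T (l m : 'I_T) :
  `|l - m|%N%:R / T%:R <= normc (circle_pt T l - circle_pt T m).
Proof.
have T0 : (0 < T)%N by case: T l {m} => // -[].
have in01 (k : 'I_T) : 0 <= (k%:R / T%:R : R) <= 1.
  rewrite divr_ge0//= ler_pdivrMr ?ltr0n// mul1r ler_nat; exact: ltnW.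
apply: le_trans (cayley_dist (in01 l) (in01 m)).
rewrite -mulrBl normrM (ger0_norm (x := _^-1)) ?invr_ge0//.
rewrite ler_wpM2r ?invr_ge0//.
have [ml|lm] := leqP m l; first by rewrite distnEl// natrB ?ler_norm.
by rewrite distnEr ?natrB ?(ltnW lm)// distrC ler_norm.
Qed.

(** A candidate may be arbitrarily close to [b], so the logarithm of the distance has no bound on
    average. It is cut at half the spacing [1 / T]; candidates below the cut are few and get
    excluded separately. The cut at 1 makes [- ln] nonnegative. *)
Definition truncated_dist (T l : nat) (b : R[i]) : R :=
  Num.min 1 (Num.max (normc (circle_pt T l - b)) (2 * T%:R)^-1).

Lemma sum_ln_truncated_dist T b :
  \sum_(l < T) - ln (truncated_dist T l b) <= 8 * T%:R.
Proof.
case: T => [|T]; first by rewrite big_ord0 mulr0.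
set n := T.+1.
have [m _ mmin] : extremum_spec <=%O xpredT
    (fun l : 'I_n => normc (circle_pt n l - b))
    [arg min_(l < ord0 | true) normc (circle_pt n l - b)]%O.
  exact: arg_minP.
have n0 : (0 : R) < n%:R by rewrite ltr0n.
(* Comparison with the nearest candidate [m] gives distance at least [j / (2 n)] at index distance
   [j], and [2 n / j <= 4 n / (j + 1)] for [j >= 1]; for [j = 0] the truncation at [1 / (2 n)] takes
   over. The maximum with 0 gives the sign that [sum_distn_le] asks for. *)
pose g j : R := Num.max 0 (ln (4 * n%:R / j.+1%:R)).
have -> : 8 * n%:R = 2 * (4 * n%:R) :> R by ring.
apply: (@le_trans _ _ (2 * \sum_(0 <= j < n) g j)); last first.
  rewrite ler_pM2l//; apply: le_trans (sum_ln_inv_le n _); last by rewrite mulr_gt0.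
  rewrite le_eqVlt; apply/orP; left; apply/eqP; apply: eq_big_nat => j /andP[_ jn].
  rewrite /g max_r// ln_ge0// ler_pdivlMr// mul1r -natrM ler_nat; lia.
apply: le_trans (sum_distn_le (ltn_ord m) _); last by move=> j; rewrite le_max lexx.
apply: ler_sum => l _; rewrite /g le_max; apply/orP; right.
have d1 : normc (circle_pt n l - b) >= `|l - m|%N%:R / n%:R / 2.
  rewrite ler_pdivrMr// (le_trans (circle_pt_dist l m))//.
  have -> : circle_pt n l - circle_pt n m =
    (circle_pt n l - b) + (b - circle_pt n m) by rewrite addrA subrK.
  rewrite (le_trans (le_normcD _ _))// mulr_natr mulr2n lerD//.
  by rewrite normcB mmin.
rewrite -lnV ?posrE; last first.
  by rewrite lt_min ltr01 lt_max invr_gt0 mulr_gt0// orbT.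
apply: ln_le.
  by rewrite invr_gt0 lt_min ltr01 lt_max invr_gt0 mulr_gt0// orbT.
rewrite -[leRHS]invrK lef_pV2 ?posrE ?invr_gt0 ?divr_gt0 ?mulr_gt0//; last first.
  by rewrite lt_min ltr01 lt_max invr_gt0 mulr_gt0// orbT.
rewrite invf_div le_min; apply/andP; split.
  rewrite ler_pdivrMr ?mulr_gt0// mul1r -natrM ler_nat.
  have : (`|l - m|%N < n)%N; last by lia.
  case: (leqP m l) => [/distnEl->|/ltnW/distnEr->];
    by rewrite (leq_ltn_trans (leq_subr _ _)) ?ltn_ord.
rewrite le_max; case: (posnP `|l - m|%N) => [->|dpos].
  apply/orP; right; rewrite mul1r lef_pV2 ?posrE ?mulr_gt0// ler_pM2r//.
  by rewrite ler_nat.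
apply/orP; left; apply: le_trans d1.
rewrite -mulrA -invfM mulrC ler_pdivrMl ?mulr_gt0//.
rewrite mulrA [leRHS](_ : _ = 2 * `|l - m|%N%:R); last by field; rewrite gt_eqF.
by rewrite -natrM ler_nat; lia.
Qed.

End unit_circle.

(** * A discrete Jensen formula *)

Section jensen.
Context (R : realType).
Implicit Types (s t : seq R[i]) (a b c w z : R[i]) (r : R).

Definition log_deriv s z : R[i] := \sum_(v <- s) (z - v)^-1.

(** By Jensen's formula, [ln r + log_plus_disc c r a] is the mean of [ln |z - a|] over the circle of
    center [c] and radius [r]. *)
Definition log_plus_disc c r a : R := ln (Num.max 1 (normc (a - c) / r)).

Lemma max1_normcX N b :
  Num.max 1 (normc (b ^+ N)) = Num.max 1 (normc b) ^+ N.
Proof.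
rewrite normcX; have [b1|b1] := leP (normc b) 1.
  by rewrite expr1n max_l// exprn_ile1// normc_ge0.
by rewrite max_r// exprn_ege1// ltW.
Qed.

Definition rescale c r a : R[i] := (a - c) / r%:C.

Lemma normc_rescale c r a : 0 < r -> normc (rescale c r a) = normc (a - c) / r.
Proof. by move=> r0; rewrite normcM normcV normc_real gtr0_norm. Qed.

Lemma sub_rescale c r a z : 0 < r ->
  normc (c + r%:C * z - a) = r * normc (z - rescale c r a).
Proof.
move=> r0; rewrite -{2}(gtr0_norm r0) -normc_real -normcM; congr normc.
rewrite mulrBr /rescale mulrCA divff ?mulr1; first by rewrite opprB addrCA addrA.
by rewrite (fmorph_eq0 (real_complex R)) gt_eqF.
Qed.

(** The mean over [N] points differs from the circle mean by a single logarithm, which carries no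
    factor [N]. *)
Lemma sum_ln_dist_roots (N : nat) w (rs : seq R[i]) c r a : 0 < r ->
  size rs = N ->
  (forall b, \prod_(z <- rs) normc (z - b) = normc (w - b ^+ N)) ->
  w != rescale c r a ^+ N ->
  \sum_(z <- rs) ln (normc (c + r%:C * z - a)) =
  N%:R * (ln r + log_plus_disc c r a) + ln (dist_ratio w (rescale c r a ^+ N)).
Proof.
move=> r0 sN prs wa; set b := rescale c r a.
have zb z : z \in rs -> 0 < normc (z - b).
  move=> zrs; rewrite normc_gt0 subr_eq0; apply: contraNneq wa => zb.
  rewrite -subr_eq0 -normc_eq0 -prs; apply/eqP.
  by rewrite (big_rem z)//= -/b zb subrr normc0 mul0r.
under eq_bigr do rewrite sub_rescale//.
rewrite big_seq; under eq_bigr do rewrite lnM ?posrE ?zb//.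
rewrite -big_seq big_split/= -(ln_prod (F := fun z => normc (z - b)))// prs.
rewrite big_const_seq count_predT sN iter_addr_0 -[_ *+ N]mulr_natl.
rewrite mulrDr -addrA; congr (_ + _).
have m0 : 0 < Num.max 1 (normc b) by rewrite lt_max ltr01.
have mN := max1_normcX N b.
have wb0 : 0 < normc (w - b ^+ N) by rewrite normc_gt0 subr_eq0.
rewrite /dist_ratio ln_div ?posrE ?mN ?exprn_gt0// lnXn// /log_plus_disc.
by rewrite -normc_rescale// -/b -[_ *+ N]mulr_natl; ring.
Qed.

Section comparison.
Variables (s t : seq R[i]).
(** The identity [P' = (P' / P) P], where [P] is monic with zeros [s] and [t] lists the zeros of
    [P']. At a point of [s] the convention [0^-1 = 0] would break it. *)
Hypothesis deriv_st : forall z, z \notin s ->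
  (size s)%:R * \prod_(x <- t) (z - x) =
  log_deriv s z * \prod_(v <- s) (z - v).
Hypothesis size_st : size s = (size t).+1.

(** Logarithms are taken in [deriv_st] and [sum_ln_dist_roots] is applied to every factor. A single
    [- ln r] survives because [t] has one point fewer than [s]. *)
Lemma sum_ln_log_deriv (N : nat) w (rs : seq R[i]) c r : 0 < r ->
  size rs = N ->
  (forall z, z \in rs -> z ^+ N = w) ->
  (forall b, \prod_(z <- rs) normc (z - b) = normc (w - b ^+ N)) ->
  (forall a, a \in s ++ t -> w != rescale c r a ^+ N) ->
  \sum_(z <- rs) ln (normc (log_deriv s (c + r%:C * z))) =
  N%:R * (ln (size s)%:R - ln r +
     (\sum_(x <- t) log_plus_disc c r x - \sum_(v <- s) log_plus_disc c r v)) +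
  (\sum_(x <- t) ln (dist_ratio w (rescale c r x ^+ N)) -
   \sum_(v <- s) ln (dist_ratio w (rescale c r v ^+ N))).
Proof.
move=> r0 sN rsw prs wst.
have rC0 : r%:C != 0 by rewrite (fmorph_eq0 (real_complex R)) gt_eqF.
have dist0 z a : z \in rs -> a \in s ++ t -> 0 < normc (c + r%:C * z - a).
  move=> zrs ast; rewrite normc_gt0 subr_eq0; apply: contraNneq (wst a ast) => <-.
  by rewrite /rescale addrC addKr mulrC mulKf// rsw.
have ins a : a \in s -> a \in s ++ t by move=> ?; rewrite mem_cat; apply/orP; left.
have int a : a \in t -> a \in s ++ t by move=> ?; rewrite mem_cat; apply/orP; right.
have lnL z : z \in rs -> ln (normc (log_deriv s (c + r%:C * z))) =
    ln (size s)%:R + \sum_(x <- t) ln (normc (c + r%:C * z - x)) -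
    \sum_(v <- s) ln (normc (c + r%:C * z - v)).
  move=> zrs; set y := c + _.
  have ys : y \notin s.
    by apply/negP => /ins /(dist0 z _ zrs); rewrite subrr normc0 ltxx.
  have pn (u : seq R[i]) : (forall a, a \in u -> a \in s ++ t) ->
      0 < \prod_(x <- u) normc (y - x).
    move=> us; rewrite big_seq; apply: prodr_gt0 => x xu.
    exact: dist0 (us _ xu).
  have := congr1 (@normc R) (deriv_st ys).
  rewrite !normcM !normc_prod normc_nat => LE.
  have n0 : (0 : R) < (size s)%:R by rewrite ltr0n size_st.
  have L0 : 0 < normc (log_deriv s y).
    by rewrite -(pmulr_lgt0 _ (pn s ins)) -LE mulr_gt0 ?pn.
  rewrite -!ln_prod; try by move=> x xu; apply: dist0 => //; auto.
  apply/eqP; rewrite eq_sym subr_eq -!lnM ?posrE ?pn// ?mulr_gt0 ?pn//.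
  by rewrite LE.
rewrite big_seq (eq_bigr _ lnL) -big_seq sumrB big_split/=.
rewrite exchange_big/= [X in _ - X]exchange_big/=.
rewrite big_const_seq count_predT sN iter_addr_0 -[_ *+ N]mulr_natl.
have E (u : seq R[i]) : (forall a, a \in u -> a \in s ++ t) ->
   \sum_(j <- u) \sum_(i <- rs) ln (normc (c + r%:C * i - j)) =
   N%:R * ((size u)%:R * ln r + \sum_(x <- u) log_plus_disc c r x) +
   \sum_(x <- u) ln (dist_ratio w (rescale c r x ^+ N)).
  move=> us; rewrite big_seq.
  rewrite (eq_bigr _ (fun j ju => sum_ln_dist_roots r0 sN prs (wst _ (us _ ju)))).
  rewrite -big_seq big_split/= -mulr_sumr big_split/=.
  by rewrite big_const_seq count_predT iter_addr_0 -[_ *+ size u]mulr_natl.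
rewrite !E// size_st -natr1; ring.
Qed.

(** In [z ^ N - b ^ N = (z - b) * (sum of N products)], each product has modulus at most
    [max 1 |b| ^ N]. Controlling [dist_ratio] at the one point [w] thus keeps all its [N]-th roots
    away from [b]. *)
Lemma normc_sub_root_ge (N : nat) z w b : (0 < N)%N -> normc w = 1 ->
  normc z = 1 -> z ^+ N = w ->
  dist_ratio w (b ^+ N) / N%:R <= normc (z - b).
Proof.
move=> N0 w1 z1 zw; rewrite ler_pdivrMr ?ltr0n// /dist_ratio.
set m := Num.max 1 (normc b).
have m1 : 1 <= m by rewrite le_max lexx.
have m0 : 0 < m by rewrite (lt_le_trans ltr01).
rewrite max1_normcX -/m ler_pdivrMr ?exprn_gt0// -zw subrXX normcM -mulrA.
apply: ler_wpM2l; first exact: normc_ge0.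
apply: le_trans (normc_le_sum _ _) _.
apply: (@le_trans _ _ (\sum_(i < N) m ^+ N)); last first.
  by rewrite sumr_const card_ord -[leLHS]mulr_natl.
apply: ler_sum => i _; rewrite normcM !normcX z1 expr1n mul1r.
apply: (@le_trans _ _ (m ^+ i)).
  by rewrite lerXn2r ?nnegrE ?normc_ge0 ?(ltW m0)// le_max lexx orbT.
by rewrite ler_weXn2l// ltnW.
Qed.

Lemma log_deriv_le (N : nat) c r z w d : (0 < N)%N -> 0 < r -> 0 < d ->
  normc w = 1 -> normc z = 1 -> z ^+ N = w ->
  (forall v, v \in s -> d <= dist_ratio w (rescale c r v ^+ N)) ->
  normc (log_deriv s (c + r%:C * z)) <= (size s)%:R * (N%:R / (r * d)).
Proof.
move=> N0 r0 d0 w1 z1 zw ds.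
rewrite (le_trans (normc_le_sum _ _))//.
have -> : (size s)%:R * (N%:R / (r * d)) = \sum_(v <- s) N%:R / (r * d) :> R.
  by rewrite big_const_seq count_predT iter_addr_0 -[RHS]mulr_natl.
rewrite !big_seq; apply: ler_sum => v vs.
rewrite normcV sub_rescale// -[leRHS]invf_div.
rewrite lef_pV2 ?posrE ?divr_gt0 ?mulr_gt0 ?ltr0n//.
  rewrite -mulrA ler_wpM2l ?(ltW r0)//.
  apply: le_trans (normc_sub_root_ge _ N0 w1 z1 zw).
  by rewrite ler_wpM2r ?invr_ge0// ds.
apply: lt_le_trans (normc_sub_root_ge _ N0 w1 z1 zw).
by rewrite divr_gt0 ?ltr0n// (lt_le_trans d0)// ds.
Qed.

End comparison.

End jensen.

Lemma card_has_le1 (I : finType) (J : Type) (f : I -> pred J) (B : seq J) :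
  (forall b, #|[set i | f i b]%SET| <= 1)%N -> (#|[set i | has (f i) B]%SET| <= size B)%N.
Proof.
move=> f1; elim: B => [|b B IH] /=.
  by rewrite (_ : [set _ | _]%SET = finset.set0) ?cards0//; apply/setP => i; rewrite !inE.
have -> : [set i | f i b || has (f i) B]%SET =
    [set i | f i b]%SET :|: [set i | has (f i) B]%SET.
  by apply/setP => i; rewrite !inE.
by rewrite (leq_trans (leq_card_setU _ _))// -add1n leq_add.
Qed.

Lemma card_markov (R : realFieldType) (I : finType) (F : I -> R) (K : R) :
  (forall i, 0 <= F i) -> #|[set i | K < F i]%SET|%:R * K <= \sum_i F i.
Proof.
move=> F0; rewrite mulr_natl -sumr_const.
rewrite (bigID (mem [set i | K < F i]%SET) xpredT)/=; apply: ler_wpDr.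
  exact: sumr_ge0.
by apply: ler_sum => i; rewrite inE => /ltW.
Qed.

Section jensen_compare.
Context (R : realType).
Variables (s t : seq R[i]).
Hypothesis deriv_st : forall z, z \notin s ->
  (size s)%:R * \prod_(x <- t) (z - x) =
  log_deriv s z * \prod_(v <- s) (z - v).
Hypothesis size_st : size s = (size t).+1.
Let n := size s.
Let T := (16 * n)%N.

(* Of the [16 n] candidates, [8 n] may be bad, each of the [2 n] points of [B] is
   close to at most one candidate, and at most [2 n] candidates have a large
   logarithmic sum. *)
Lemma good_circle_pt (B : seq R[i]) (Bad : {set 'I_T}) :
  (size B <= 2 * n)%N -> (#|Bad| <= 8 * n)%N ->
  exists l : 'I_T, [/\ l \notin Bad,
    forall b, b \in B -> (2 * T%:R)^-1 <= normc (circle_pt R T l - b) &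
    \sum_(b <- B) - ln (truncated_dist T l b) <= 128 * n%:R].
Proof.
move=> sB cBad; have n0 : (0 < n)%N by rewrite /n size_st.
have T0 : (0 : R) < T%:R by rewrite ltr0n muln_gt0.
pose near (l : 'I_T) b := normc (circle_pt R T l - b) < (2 * T%:R)^-1.
(* Two candidates closer than [1 / (2 T)] to the same [b] would be closer than [1 / T] to each
   other, against their spacing. *)
have cNear : (#|[set l | has (near l) B]%SET| <= 2 * n)%N.
  apply: leq_trans sB; apply: card_has_le1 => b.
  apply/card_le1_eqP => l m; rewrite !inE => lb mb; apply/eqP/negPn/negP => lm.
  have : `|l - m|%N%:R / T%:R < T%:R^-1 :> R.
    apply: le_lt_trans (circle_pt_dist R l m) _.
    have -> : circle_pt R T l - circle_pt R T m =
      (circle_pt R T l - b) + (b - circle_pt R T m) by rewrite addrA subrK.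
    rewrite (le_lt_trans (le_normcD _ _))//.
    have -> : T%:R^-1 = (2 * T%:R)^-1 + (2 * T%:R)^-1 :> R.
      by field; rewrite gt_eqF.
    by rewrite ltrD// normcB.
  rewrite ltr_pdivrMr// mulVf ?gt_eqF// -[1]/(1%:R) ltr_nat ltnS leqn0.
  by rewrite distn_eq0 eq_sym; apply/negP.
pose F (l : 'I_T) : R := \sum_(b <- B) - ln (truncated_dist T l b).
have F0 l : 0 <= F l.
  by apply: sumr_ge0 => b _; rewrite oppr_ge0 ln_le0// ge_min lexx.
(* The sum of [F] over all candidates is at most [2 n * 8 T = 2 n * 128 n], whence the threshold
   [128 n]. The three exclusions remove at most [12 n] of the [16 n] candidates. *)
have cHeavy : (#|[set l | (128 * n%:R < F l)%R]%SET| <= 2 * n)%N.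
  have := card_markov (128 * n%:R) F0.
  rewrite /F exchange_big/= => /le_trans.
  move=> /(_ (\sum_(b <- B) 8 * T%:R)).
  move=> /(_ (ler_sum _ (fun b _ => sum_ln_truncated_dist T b))).
  rewrite big_const_seq count_predT iter_addr_0 -[_ *+ size B]mulr_natl.
  rewrite -!natrM ler_nat => h.
  have : (#|[set l | ((128 * n)%:R < F l)%R]%SET| * (128 * n) <= (2 * n) * (128 * n))%N.
    apply: leq_trans h _; rewrite /T.
    by apply: leq_trans (leq_mul sB (leqnn _)) _; lia.
  by rewrite leq_pmul2r// muln_gt0.
pose U := (Bad :|: [set l | has (near l) B]%SET) :|: [set l | 128 * n%:R < F l]%SET.
have cU : (#|U| < #|'I_T|)%N.
  rewrite card_ord (leq_ltn_trans (leq_card_setU _ _))//.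
  apply: leq_ltn_trans (leq_add (leq_card_setU _ _) (leqnn _)) _.
  apply: leq_ltn_trans (leq_add (leq_add cBad cNear) cHeavy) _.
  by rewrite /T; lia.
have [l lU] : exists l, l \notin U.
  apply/existsP; rewrite -negb_forall; apply: contraTN cU => /forallP h.
  by rewrite -leqNgt subset_leq_card//; apply/fintype.subsetP => l _; exact: h.
move: lU; rewrite !inE !negb_or -leNgt => /andP[/andP[lBad lnear] lF].
exists l; split=> // b bB.
by rewrite leNgt; apply: contra lnear => nb; apply/hasP; exists b.
Qed.

(** [Bad] collects the candidates with a root at which [|L|] may be small. For any other one, the
    mean of [ln |L|] over the roots is squeezed between [- e] and a logarithm of a power of [n]. In
    [130 n], the part [128 n] is the bound of [good_circle_pt] and [2 n] comes from [ln 2 <= 1] at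
    each point of [B]. *)
Lemma jensen_compare (c : R[i]) (r e : R) (N : nat) (Bad : {set 'I_T}) :
  0 < r -> 0 <= e -> (0 < N)%N -> (#|Bad| <= 8 * n)%N ->
  (forall (l : 'I_T) z, l \notin Bad -> z ^+ N = circle_pt R T l ->
    expR (- e) <= normc (log_deriv s (c + r%:C * z))) ->
  `|\sum_(x <- t) log_plus_disc c r x - \sum_(v <- s) log_plus_disc c r v| <=
  130 * n%:R / N%:R + e + (3 * ln n%:R + 2 * `|ln r| + ln (64 * N%:R)).
Proof.
move=> r0 e0 N0 cBad goodL.
have n0 : (0 < n)%N by rewrite /n size_st.
have nR0 : (0 : R) < n%:R by rewrite ltr0n.
have NR0 : (0 : R) < N%:R by rewrite ltr0n.
have T0 : (0 : R) < T%:R by rewrite ltr0n muln_gt0.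
pose B := [seq rescale c r a ^+ N | a <- s ++ t].
have sB : (size B <= 2 * n)%N.
  by rewrite size_map size_cat -/n; move: size_st; rewrite -/n; lia.
have [l [lBad lB lsum]] := good_circle_pt sB cBad.
set w := circle_pt R T l in lB.
have w1 : normc w = 1 by exact: normc_circle_pt.
have inB a : a \in s ++ t -> rescale c r a ^+ N \in B by move=> ?; exact: map_f.
have T2 : 0 < (2 * T%:R)^-1 :> R by rewrite invr_gt0 mulr_gt0.
have wB a : a \in s ++ t -> w != rescale c r a ^+ N.
  move=> /inB /lB h; rewrite -subr_eq0 -normc_eq0 gt_eqF//.
  exact: lt_le_trans h.
have [rs [srs rsw rs1 prs]] := unity_roots_seq N0 w1.
have := sum_ln_log_deriv deriv_st size_st r0 srs rsw prs wB.
set D := _ - \sum_(v <- s) log_plus_disc c r v.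
set k := (X in _ + X).
rewrite -/n => E.
have kn : `|k| <= 130 * n%:R.
  have : `|k| <= \sum_(b <- B) `|ln (dist_ratio w b)|.
    rewrite /k big_map big_cat/= addrC (le_trans (ler_normB _ _))//.
    by rewrite lerD// ler_norm_sum.
  move/le_trans; apply.
  apply: (@le_trans _ _ (\sum_(b <- B) (ln 2 - ln (truncated_dist T l b)))).
    rewrite !big_seq; apply: ler_sum => b /[dup] bB /lB wb.
    rewrite /truncated_dist max_l// abs_ln_dist_ratio//.
    by rewrite -subr_eq0 -normc_eq0 gt_eqF// (lt_le_trans _ wb).
  rewrite big_split/= [130 * _](_ : _ = 2 * n%:R + 128 * n%:R); last by ring.
  rewrite lerD// big_const_seq count_predT iter_addr_0 -[_ *+ _]mulr_natl.
  apply: (@le_trans _ _ ((size B)%:R * 1)).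
    rewrite ler_wpM2l// -[X in ln X]/(1 + 1).
    by rewrite (le_trans (le_ln1Dx _))// (lt_trans _ ltr01)// ltrN10.
  by rewrite mulr1 -natrM ler_nat.
(* Candidates kept are at distance at least [1 / (2 T) = 1 / (32 n)], and [dist_ratio_ge] loses a
   factor 2. *)
pose d : R := (64 * n%:R)^-1.
have d0 : 0 < d by rewrite invr_gt0 mulr_gt0.
have dB v : v \in s -> d <= dist_ratio w (rescale c r v ^+ N).
  move=> vs; apply: le_trans (dist_ratio_ge _ w1).
  rewrite ler_pdivlMr// le_min; apply/andP; split.
    have n1 : (1 : R) <= n%:R by rewrite ler1n.
    by rewrite mulrC ler_pdivrMr ?mulr_gt0// mul1r; lra.
  have /inB /lB : v \in s ++ t by rewrite mem_cat vs.
  apply: le_trans; rewrite /d /T natrM.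
  rewrite [leRHS](_ : _ = (64 * n%:R)^-1 * 2)//.
  by field; rewrite gt_eqF.
(* The upper bound for [|L|] is [n N / (r d) = 64 N n ^ 2 / r]. The third [ln n] and the second
   [|ln r|] of the conclusion come from the term [ln n - ln r] of [sum_ln_log_deriv]. *)
pose M : R := e + `|ln r| + 2 * ln n%:R + ln (64 * N%:R).
have lnn0 : 0 <= ln n%:R :> R by rewrite ln_ge0// ler1n.
have lnN0 : 0 <= ln (64 * N%:R) :> R.
  by rewrite ln_ge0// -natrM ler1n muln_gt0.
have LM z : z \in rs -> `|ln (normc (log_deriv s (c + r%:C * z)))| <= M.
  move=> zrs; have zw := rsw _ zrs; have z1 := rs1 _ zrs.
  have Llow := goodL l z lBad zw.
  have Lup := log_deriv_le N0 r0 d0 w1 z1 zw dB.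
  have L0 := lt_le_trans (expR_gt0 _) Llow.
  rewrite ler_norml; apply/andP; split.
    apply: (@le_trans _ _ (- e)); last by rewrite -[leLHS]expRK ln_le// expR_gt0.
    by rewrite lerNl opprK /M -!addrA lerDl !addr_ge0// mulr_ge0.
  apply: le_trans (ln_le L0 Lup) _.
  rewrite [X in ln X](_ : _ = (64 * N%:R) * n%:R ^+ 2 / r); last first.
    by rewrite /d -/n; field; rewrite !gt_eqF.
  rewrite ln_div ?posrE ?mulr_gt0 ?exprn_gt0// lnM ?posrE ?mulr_gt0 ?exprn_gt0//.
  rewrite lnXn// -[_ *+ 2]mulr_natl /M.
  have := ler_norm (- ln r); rewrite normrN => h.
  rewrite [leLHS](_ : _ = - ln r + (2 * ln n%:R + ln (64 * N%:R))); last by ring.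
  by rewrite -!addrA ler_wpDl// lerD.
have {E} ND : N%:R * D = \sum_(z <- rs) ln (normc (log_deriv s (c + r%:C * z)))
    - N%:R * (ln n%:R - ln r) - k by rewrite E; ring.
rewrite -(ler_pM2l NR0) -{1}(gtr0_norm NR0) -normrM ND.
apply: le_trans (ler_normB _ _) _.
apply: le_trans (lerD (ler_normB _ _) kn) _.
have h1 : `|\sum_(z <- rs) ln (normc (log_deriv s (c + r%:C * z)))| <= N%:R * M.
  apply: le_trans (ler_norm_sum _ _ _) _.
  rewrite -[leRHS](_ : \sum_(z <- rs) M = _).
    by rewrite !big_seq; apply: ler_sum.
  by rewrite big_const_seq count_predT iter_addr_0 srs -[_ *+ _]mulr_natl.
have h2 : `|N%:R * (ln n%:R - ln r)| <= N%:R * (ln n%:R + `|ln r|).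
  rewrite normrM gtr0_norm// ler_wpM2l// (le_trans (ler_normB _ _))//.
  by rewrite ger0_norm.
apply: le_trans (lerD (lerD h1 h2) (lexx _)) _.
rewrite le_eqVlt; apply/orP; left; apply/eqP; rewrite /M; field.
by rewrite gt_eqF.
Qed.

End jensen_compare.

(** * Density of logarithmic bumps *)

Section bumps.
Context (R : realType).
Implicit Types (a b c z : R[i]) (r : R) (f g : R[i] -> R).

Lemma ler_dist_ln_max1 (x y : R) :
  `|ln (Num.max 1 x) - ln (Num.max 1 y)| <= `|x - y|.
Proof.
wlog xy : x y / x <= y => [h|].
  have [/h//|/ltW yx] := leP x y.
  by rewrite distrC [leRHS]distrC; exact: h.
have m1 (u : R) : 1 <= Num.max 1 u by rewrite le_max lexx.
have m0 (u : R) : 0 < Num.max 1 u by exact: lt_le_trans (m1 u).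
have mxy : Num.max 1 x <= Num.max 1 y.
  by rewrite ge_max m1/= le_max xy orbT.
rewrite distrC ger0_norm ?subr_ge0 ?ln_le// -ln_div ?posrE//.
have -> : Num.max 1 y / Num.max 1 x =
    1 + (Num.max 1 y - Num.max 1 x) / Num.max 1 x.
  by field; rewrite gt_eqF.
apply: (@le_trans _ _ ((Num.max 1 y - Num.max 1 x) / Num.max 1 x)).
  apply: le_ln1Dx; rewrite (lt_le_trans (ltrN10 R))// divr_ge0 ?subr_ge0//.
  exact: ltW.
rewrite ler_pdivrMr// (@le_trans _ _ `|x - y|)//.
  rewrite distrC ger0_norm ?subr_ge0// lerBlDr ge_max.
  have xm : x <= Num.max 1 x by rewrite le_max lexx orbT.
  by have := m1 x; move=> ?; apply/andP; split; lra.
by rewrite ler_peMr.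
Qed.

(** The capacitary potential of an annulus: 1 on the disc of radius [r], 0 outside that of radius
    [2 r], and [ln (2 r / |a - c|) / ln 2] in between. *)
Definition bump c r a : R :=
  (ln 2 - log_plus_disc c r a + log_plus_disc c (2 * r) a) / ln 2.

Let ln2_gt0 : 0 < ln (2 : R).
Proof. by rewrite ln_gt0// ltr1n. Qed.

Lemma bump1 c r a : 0 < r -> normc (a - c) <= r -> bump c r a = 1.
Proof.
move=> r0 ar; rewrite /bump /log_plus_disc !max_l; last 2 first.
- by rewrite ler_pdivrMr ?mulr_gt0// mul1r (le_trans ar)// ler_peMl ?ler1n ?ltW.
- by rewrite ler_pdivrMr// mul1r.
by rewrite ln1 subr0 addr0 divff// gt_eqF.
Qed.

Lemma bump0 c r a : 0 < r -> 2 * r <= normc (a - c) -> bump c r a = 0.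
Proof.
move=> r0; rewrite /bump /log_plus_disc; move: (normc (a - c)) => x rx.
have x0 : 0 < x by rewrite (lt_le_trans _ rx)// mulr_gt0.
rewrite !max_r; last 2 first.
- by rewrite ler_pdivlMr ?mulr_gt0// mul1r.
- by rewrite ler_pdivlMr// mul1r (le_trans _ rx)// ler_peMl ?ler1n ?ltW.
rewrite !ln_div ?posrE ?mulr_gt0// lnM ?posrE//.
by rewrite [X in X / _](_ : _ = 0) ?mul0r//; ring.
Qed.

Lemma bump_ge0 c r a : 0 < r -> 0 <= bump c r a.
Proof.
move=> r0; rewrite /bump divr_ge0 ?(ltW ln2_gt0)//.
rewrite /log_plus_disc addrAC subr_ge0 -lnM ?posrE ?lt_max ?ltr01//.
apply: ln_le; first by rewrite lt_max ltr01.
rewrite ge_max; apply/andP; split.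
  by rewrite mulrC -[leLHS]mul1r ler_pM ?ler1n// le_max lexx.
rewrite maxr_pMr// le_max; apply/orP; right.
rewrite le_eqVlt; apply/orP; left; apply/eqP; field.
by rewrite gt_eqF.
Qed.

Lemma bump_le1 c r a : 0 < r -> bump c r a <= 1.
Proof.
move=> r0; rewrite /bump ler_pdivrMr// mul1r -addrA gerDl addrC subr_le0.
rewrite /log_plus_disc ln_le ?lt_max ?ltr01//.
rewrite ge_max !le_max lexx/=; apply/orP; right.
rewrite ler_wpM2l ?normc_ge0// lef_pV2 ?posrE ?mulr_gt0//.
by rewrite ler_peMl ?ler1n ?ltW.
Qed.

Lemma bump_lipschitz c r : 0 < r ->
  exists2 L, 0 <= L & forall a b, `|bump c r a - bump c r b| <= L * normc (a - b).
Proof.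
move=> r0.
have lpd s a b : 0 < s -> `|log_plus_disc c s a - log_plus_disc c s b| <=
    s^-1 * normc (a - b).
  move=> s0; rewrite /log_plus_disc (le_trans (ler_dist_ln_max1 _ _))//.
  rewrite -mulrBl normrM [X in _ * X]gtr0_norm ?invr_gt0// mulrC.
  rewrite ler_wpM2l ?invr_ge0 ?(ltW s0)//.
  apply: le_trans (ler_normc_dist _ _) _.
  by rewrite opprB addrA subrK.
exists ((r^-1 + (2 * r)^-1) / ln 2).
  by rewrite divr_ge0 ?addr_ge0 ?invr_ge0 ?mulr_ge0 ?(ltW r0) ?(ltW ln2_gt0).
move=> a b; rewrite /bump -mulrBl normrM [X in _ * X]gtr0_norm ?invr_gt0//.
rewrite mulrAC ler_wpM2r ?invr_ge0 ?(ltW ln2_gt0)// [leRHS]mulrDl.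
have E (p q u q' u' : R) : p - q + u - (p - q' + u') = - (q - q') + (u - u').
  by ring.
rewrite E.
by rewrite (le_trans (ler_normD _ _))// normrN lerD// lpd// mulr_gt0.
Qed.

(** Uniform continuity and bounded support survive the subtraction of a sum of bumps, which
    smoothness would not; this allows the approximation to be iterated. *)
Definition unif_cont_plane f := forall e : R, 0 < e ->
  exists2 d, 0 < d & forall a b, normc (a - b) <= d -> `|f a - f b| <= e.

Definition bounded_support f := exists K, forall z, K < normc z -> f z = 0.

Definition bump_sum (s : seq (R * R[i] * R)) z : R :=
  \sum_(p <- s) p.1.1 * bump p.1.2 p.2 z.

Definition pos_radii (s : seq (R * R[i] * R)) := forall p, p \in s -> 0 < p.2.

Lemma bump_sum_lipschitz s : pos_radii s -> exists2 L, 0 <= L &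
  forall a b, `|bump_sum s a - bump_sum s b| <= L * normc (a - b).
Proof.
elim: s => [|p s IH] sr.
  by exists 0 => // a b; rewrite /bump_sum !big_nil subrr normr0 mul0r.
have [L L0 Ls] := IH (fun q qs => sr q (mem_behead (s := p :: s) qs)).
have [L1 L10 Lp] := bump_lipschitz p.1.2 (sr p (mem_head _ _)).
exists (`|p.1.1| * L1 + L); first by rewrite addr_ge0 ?mulr_ge0.
move=> a b; rewrite /bump_sum !big_cons -!/(bump_sum s _).
rewrite opprD addrACA -mulrBr [leRHS]mulrDl (le_trans (ler_normD _ _))// lerD//.
by rewrite normrM -mulrA ler_wpM2l.
Qed.

Lemma bump_sum_bounded_support s : pos_radii s -> bounded_support (bump_sum s).
Proof.
elim: s => [|p s IH] sr; first by exists 0 => z _; rewrite /bump_sum big_nil.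
have [K Ks] := IH (fun q qs => sr q (mem_behead (s := p :: s) qs)).
have p0 := sr p (mem_head _ _).
exists (Num.max K (2 * p.2 + normc p.1.2)) => z; rewrite gt_max => /andP[/Ks zK].
rewrite -ltrBrDr => zp.
rewrite /bump_sum big_cons -/(bump_sum s _) zK bump0 ?mulr0 ?addr0// ltW//.
apply: lt_le_trans zp _.
by rewrite (le_trans (ler_norm _))// ler_normc_dist.
Qed.

Lemma unif_cont_sub_bump_sum f s : pos_radii s -> unif_cont_plane f ->
  unif_cont_plane (fun z => f z - bump_sum s z).
Proof.
move=> sr uf e e0; have [L L0 Ls] := bump_sum_lipschitz sr.
have [d d0 fd] := uf (e / 2) (divr_gt0 e0 (ltr0Sn _ _)).
have L1 : 0 < L + 1 by rewrite ltr_wpDl.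
exists (Num.min d (e / 2 / (L + 1))).
  by rewrite lt_min d0 !divr_gt0.
move=> a b; rewrite le_min => /andP[/fd fab abL].
rewrite opprB addrACA [X in `|X|](_ : _ =
  (f a - f b) + - (bump_sum s a - bump_sum s b)); last by ring.
rewrite (le_trans (ler_normD _ _))// normrN [e]splitr lerD//.
apply: le_trans (Ls a b) _.
move: abL; rewrite ler_pdivlMr// => /(le_trans _); apply.
by rewrite mulrC ler_wpM2l ?normc_ge0// lerDl.
Qed.

Lemma card_window (M n : nat) (P : pred 'I_M) :
  (forall i j, P i -> P j -> (i < j + n)%N) -> (#|P| <= n)%N.
Proof.
move=> Pn; have [i0 Pi0|P0] := pickP P; last by rewrite eq_card0.
case: (arg_minnP (fun i : 'I_M => i : nat) Pi0) => m Pm mmin.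
rewrite cardE -(size_map val) -(size_iota m n); apply: uniq_leq_size.
  by rewrite map_inj_uniq ?enum_uniq//; exact: val_inj.
move=> _ /mapP[i iP ->]; rewrite mem_iota.
have Pi : P i by move: iP; rewrite mem_enum.
by rewrite mmin// Pn.
Qed.

Section lattice.
Variables (K m : R) (M : nat).
Hypothesis m0 : 0 < m.

Definition lattice_pt (p : 'I_M * 'I_M) : R[i] :=
  (m * p.1%:R - K) +i* (m * p.2%:R - K).

(** A bump of radius [2 m] lives within distance [4 m], which leaves at most 8 indices for each
    coordinate. *)
Lemma lattice_overlap z :
  \sum_(p : 'I_M * 'I_M) bump (lattice_pt p) (2 * m) z <= 64.
Proof.
have r0 : 0 < 2 * m by rewrite mulr_gt0.
pose near (x : R) (i : 'I_M) := `|m * i%:R - K - x| < 4 * m.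
have cnear x : (#|near x| <= 8)%N.
  apply: card_window => i j; rewrite /near !ltr_norml => /andP[_ iu] /andP[jl _].
  rewrite -(ltr_nat R) natrD -(ltr_pM2l m0); lra.
pose x := complex.Re z; pose y := complex.Im z.
apply: (@le_trans _ _ (\sum_(p : 'I_M * 'I_M) ((near x p.1) && (near y p.2))%:R)).
  apply: ler_sum => p _.
  have [zp|zp] := leP (2 * (2 * m)) (normc (z - lattice_pt p)).
    by rewrite bump0.
  have -> : near x p.1 && near y p.2 = true; last by rewrite bump_le1.
  have E : 4 * m = 2 * (2 * m) by ring.
  rewrite /near E /x /y; apply/andP; split; apply: le_lt_trans zp; rewrite normcB.
    by apply: le_trans (Re_le_normc _); case: z {x y}.
  by apply: le_trans (Im_le_normc _); case: z {x y}.
rewrite -(pair_bigA _ (fun i j => ((near x i) && (near y j))%:R))/=.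
rewrite (eq_bigr (fun i => (near x i)%:R * \sum_j (near y j)%:R)) => [|i _].
  rewrite -mulr_suml -!natr_sum -natrM -!big_mkcond/= !sum1_card.
  by rewrite ler_nat (leq_mul (cnear x) (cnear y)).
by rewrite mulr_sumr; apply: eq_bigr => j _; rewrite -mulnb natrM.
Qed.

(** Rounding down both coordinates moves [z] by at most [m] in each, hence by at most [2 m]. *)
Lemma lattice_cover z : 0 <= K -> 2 * K / m < M%:R -> normc z <= K ->
  exists p, bump (lattice_pt p) (2 * m) z = 1.
Proof.
move=> K0 KM zK.
have coord x : `|x| <= K -> exists i : 'I_M, `|x - (m * i%:R - K)| <= m.
  rewrite ler_norml => /andP[xl xu].
  have xm0 : 0 <= (x + K) / m by rewrite divr_ge0 ?(ltW m0)//; lra.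
  have := Num.Theory.truncn_itv xm0; set i := Num.truncn _ => /andP[il iu].
  have iM : (i < M)%N.
    rewrite -(ltr_nat R); apply: le_lt_trans il _; apply: le_lt_trans KM.
    by rewrite ler_wpM2r ?invr_ge0 ?(ltW m0)//; lra.
  exists (Ordinal iM) => /=.
  move: il iu; rewrite ler_pdivlMr// ltr_pdivrMr// -natr1 => il iu.
  by rewrite ler_norml; apply/andP; split; lra.
have [i iz] := coord _ (le_trans (Re_le_normc z) zK).
have [j jz] := coord _ (le_trans (Im_le_normc z) zK).
exists (i, j); rewrite bump1 ?mulr_gt0//.
apply: le_trans (normc_le_ReIm _) _.
rewrite [leRHS](_ : _ = m + m); last by ring.
by case: z zK iz jz => zx zy /= zK iz jz; rewrite lerD.
Qed.

End lattice.

(* On a lattice of mesh [m] much finer than the modulus of continuity of [f], the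
   bumps of radius [2 m] cover every point at least once and at most 64 times:
   subtracting [f / 64] times them removes a fixed proportion of [f]. *)
Lemma bump_contraction f (A : R) : unif_cont_plane f -> bounded_support f ->
  0 < A -> (forall z, `|f z| <= A) ->
  exists2 s, pos_radii s & forall z, `|f z - bump_sum s z| <= 127 / 128 * A.
Proof.
move=> uf [K0 fK0] A0 fA.
pose K := Num.max 0 K0.
have fK z : K < normc z -> f z = 0 by rewrite gt_max => /andP[_ /fK0].
have Kge0 : 0 <= K by rewrite le_max lexx.
have [d d0 fd] := uf (A / 128) (divr_gt0 A0 (ltr0Sn _ _)).
(* Bumps of radius [2 m] vanish beyond distance [4 m = d], within which [f] varies by at most
   [A / 128]. *)
pose m := d / 4; have m0 : 0 < m by rewrite divr_gt0.
pose M := (Num.truncn (2 * K / m)).+1.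
have KM : 2 * K / m < M%:R.
  by rewrite Num.Theory.truncnS_gt.
pose q (p : 'I_M * 'I_M) : R[i] := lattice_pt K m p.
pose s := [seq (f (q p) / 64, q p, 2 * m) | p <- enum {: 'I_M * 'I_M}].
exists s => [_ /mapP[p _ ->]|z]; first by rewrite mulr_gt0.
have -> : bump_sum s z = \sum_p f (q p) / 64 * bump (q p) (2 * m) z.
  by rewrite /bump_sum big_map big_enum.
pose G := \sum_p bump (q p) (2 * m) z.
have G64 : G <= 64 by exact: lattice_overlap.
have r0 : 0 < 2 * m by rewrite mulr_gt0.
have G0 : 0 <= G by apply: sumr_ge0 => p _; exact: bump_ge0.
(* Where [f z] is nonzero, [1 <= G <= 64], so the first term is at most [63 / 64 * A]; the second is
   at most [A / 128]. Together they give [127 / 128 * A]. *)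
have -> : f z - \sum_p f (q p) / 64 * bump (q p) (2 * m) z =
    f z * (1 - G / 64) + \sum_p (f z - f (q p)) / 64 * bump (q p) (2 * m) z.
  have -> : \sum_p (f z - f (q p)) / 64 * bump (q p) (2 * m) z =
      f z * (G / 64) - \sum_p f (q p) / 64 * bump (q p) (2 * m) z.
    rewrite /G mulr_suml mulr_sumr -sumrB; apply: eq_bigr => p _; ring.
  ring.
have h2 : `|\sum_p (f z - f (q p)) / 64 * bump (q p) (2 * m) z| <= A / 128 * (G / 64).
  apply: le_trans (ler_norm_sum _ _ _) _.
  rewrite /G mulr_suml mulr_sumr; apply: ler_sum => p _.
  have [zp|zp] := leP (2 * (2 * m)) (normc (z - q p)).
    by rewrite bump0// mul0r !mulr0 normr0.
  have b64 : 0 <= bump (q p) (2 * m) z / 64.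
    by apply: divr_ge0 => //; exact: bump_ge0.
  rewrite -mulrA [_^-1 * _]mulrC normrM (ger0_norm b64).
  rewrite ler_wpM2r// fd// (le_trans (ltW zp))//.
  by rewrite /m le_eqVlt; apply/orP; left; apply/eqP; field.
have h1 : `|f z * (1 - G / 64)| <= A * (1 - 1 / 64).
  have [zK|/fK ->] := leP (normc z) K; last first.
    by rewrite mul0r normr0 mulr_ge0 ?(ltW A0)//; lra.
  have [p p1] := lattice_cover m0 Kge0 KM zK.
  have G1 : 1 <= G.
    by rewrite -p1 /G (bigD1 p)//= lerDl sumr_ge0// => i _; exact: bump_ge0.
  rewrite normrM [X in _ * X]ger0_norm; last lra.
  by apply: ler_pM => //; lra.
apply: le_trans (ler_normD _ _) _; apply: le_trans (lerD h1 h2) _.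
have : A / 128 * (G / 64) <= A / 128 by rewrite ler_piMr//; lra.
lra.
Qed.

(** The segment from 0 to a point of the support is cut into [N] steps of length at most [d], each
    changing [f] by at most 1. *)
Lemma unif_cont_bounded f : unif_cont_plane f -> bounded_support f ->
  exists2 A, 0 < A & forall z, `|f z| <= A.
Proof.
move=> uf [K fK]; have [d d0 fd] := uf 1 ltr01.
pose N := (Num.truncn (`|K| / d)).+1.
have NK : `|K| / d < N%:R by rewrite Num.Theory.truncnS_gt.
exists (N%:R + `|f 0| + 1) => [|z]; first by rewrite ltr_wpDl ?addr_ge0.
have [zK|/fK ->] := leP (normc z) K; last by rewrite normr0 !addr_ge0.
pose w k : R[i] := (k%:R / N%:R)%:C * z.
have N0 : (0 : R) < N%:R by rewrite ltr0n.
have wS k : normc (w k.+1 - w k) <= d.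
  rewrite -mulrBl -rmorphB -mulrBl -natr1 addrAC subrr add0r mul1r.
  rewrite normcM normc_real gtr0_norm ?invr_gt0// mulrC ler_pdivrMr//.
  apply: le_trans zK _; apply: le_trans (ler_norm _) _.
  by move: NK; rewrite ltr_pdivrMr// mulrC => /ltW.
have fw k : `|f (w k)| <= k%:R + `|f 0|.
  elim: k => [|k IH]; first by rewrite /w mul0r mul0r add0r.
  rewrite -(subrK (f (w k)) (f (w k.+1))) (le_trans (ler_normD _ _))//.
  by rewrite -natr1 addrAC addrC lerD// fd.
have := fw N; rewrite /w divff ?gt_eqF// mul1r => /le_trans; apply.
by rewrite lerDl.
Qed.

Lemma bump_sum_dense f : unif_cont_plane f -> bounded_support f ->
  forall e : R, 0 < e -> exists2 s, pos_radii s &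
    forall z, `|f z - bump_sum s z| <= e.
Proof.
move=> uf sf e e0.
have [A A0 fA] := unif_cont_bounded uf sf.
have iter k : exists2 s, pos_radii s &
    forall z, `|f z - bump_sum s z| <= (127 / 128) ^+ k * A.
  elim: k => [|k [s sr fs]].
    by exists [::] => // z; rewrite /bump_sum big_nil subr0 mul1r.
  have [L Ls] := bump_sum_bounded_support sr; have [K fK] := sf.
  have [||t tr ft] := bump_contraction (unif_cont_sub_bump_sum sr uf) _ _ fs.
  - exists (Num.max K L) => z; rewrite gt_max => /andP[/fK -> /Ls ->].
    by rewrite subr0.
  - by rewrite mulr_gt0 ?exprn_gt0.
  exists (s ++ t) => [p|z]; first by rewrite mem_cat => /orP[/sr|/tr].
  by rewrite /bump_sum big_cat/= opprD addrA exprS -mulrA ft.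
have [k kA] : exists k, (127 / 128) ^+ k * A <= e.
  have : (fun k => (127 / 128 : R) ^+ k) @ \oo --> (0 : R).
    by apply: cvg_expr; rewrite ger0_norm//; lra.
  move/cvgrPdist_le => /(_ (e / A) (divr_gt0 e0 A0)) [k _ kh].
  exists k; have := kh k (leqnn k).
  by rewrite sub0r normrN ger0_norm ?exprn_ge0// ler_pdivlMr.
have [s sr fs] := iter k; exists s => // z; exact: le_trans (fs z) kA.
Qed.

End bumps.

(** * Test functions and empirical measures *)

Section plane_measurability.
Context (R : realType).

Lemma measurable_Re : measurable_fun [set: R[i]] (@complex.Re R).
Proof.
move=> _ Y mY; rewrite setTI; apply/measurable_complexE => /=.
have : measurable_fun [set: R * R] (@fst R R) by exact: measurable_fst.
by move=> /(_ measurableT _ mY); rewrite setTI.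
Qed.

Lemma measurable_Im : measurable_fun [set: R[i]] (@complex.Im R).
Proof.
move=> _ Y mY; rewrite setTI; apply/measurable_complexE => /=.
have : measurable_fun [set: R * R] (@snd R R) by exact: measurable_snd.
by move=> /(_ measurableT _ mY); rewrite setTI.
Qed.

Lemma measurable_normc_sub (c : R[i]) :
  measurable_fun [set: R[i]] (fun z => normc (z - c)).
Proof.
rewrite (_ : (fun _ => _) = (fun z => Num.sqrt
    ((complex.Re z - complex.Re c) ^+ 2 + (complex.Im z - complex.Im c) ^+ 2))).
  apply: (measurableT_comp (continuous_measurable_fun (@sqrt_continuous R))).
  by apply: measurable_funD; apply: measurable_funX; apply: measurable_funB => //;
    [exact: measurable_Re|exact: measurable_Im].
by apply/funext => z; rewrite normc_sqrtE; case: z; case: c.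
Qed.

Lemma measurable_log_plus_disc (c : R[i]) (r : R) :
  measurable_fun [set: R[i]] (log_plus_disc c r).
Proof.
apply: (measurableT_comp (@measurable_ln R)); apply: measurable_maxr => //.
by apply: measurable_funM => //; exact: measurable_normc_sub.
Qed.

Lemma measurable_bump_sum (s : seq (R * R[i] * R)) :
  measurable_fun [set: R[i]] (bump_sum s).
Proof.
elim: s => [|p s IH].
  by rewrite (_ : bump_sum [::] = cst 0)//; apply/funext => z; rewrite /bump_sum big_nil.
rewrite (_ : bump_sum _ = (fun z => p.1.1 * bump p.1.2 p.2 z + bump_sum s z)).
  apply: measurable_funD => //; apply: measurable_funM => //.
  apply: measurable_funM => //; apply: measurable_funD => //.
    by apply: measurable_funB => //; exact: measurable_log_plus_disc.
  exact: measurable_log_plus_disc.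
by apply/funext => z; rewrite /bump_sum big_cons.
Qed.

(** A pointwise limit of sums of bumps, whose measurability can be read off their formula. *)
Lemma measurable_unif_cont (f : R[i] -> R) :
  unif_cont_plane f -> bounded_support f -> measurable_fun [set: R[i]] f.
Proof.
move=> uf sf.
have /choice[h hf] (n : nat) : exists g : R[i] -> R,
    measurable_fun [set: R[i]] g /\ forall z, `|f z - g z| <= n.+1%:R^-1.
  have n0 : (0 : R) < n.+1%:R^-1 by rewrite invr_gt0.
  have [s sr fs] := bump_sum_dense uf sf n0.
  by exists (bump_sum s); split => //; exact: measurable_bump_sum.
apply: (@measurable_fun_cvg _ _ _ _ h) => [n|z _]; first by case: (hf n).
apply/cvgrPdist_le => e e0; near=> n.
case: (hf n) => _ /(_ z) /le_trans; apply.
rewrite -[leRHS]invrK lef_pV2 ?posrE ?invr_gt0//.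
rewrite (@le_trans _ _ n%:R)// ?ler_nat//.
by near: n; exact: nbhs_infty_ger.
Unshelve. all: by end_near. Qed.

Lemma Cc_infty_unif_cont (f : R[i] -> R) : Cc_infty f -> unif_cont_plane f.
Proof.
move=> [/(_ 0%N) /= cf cptK] e e0.
set g := (fun p : R * R => f (p.1 +i* p.2)) in cf cptK.
set K := closure _ in cptK.
(* Here [q] ranges over the whole plane and not only over the support, so that pairs with just one
   point in the support are covered as well. *)
pose P (d : R) (p : R * R) := forall q : R * R,
  `|p.1 - q.1| <= d -> `|p.2 - q.2| <= d -> `|g p - g q| <= e.
have : \forall d \near 0^'+, K `<=` P d.
  apply: (proj1 (compact_near_coveringP K) cptK) => p Kp.
  have e2 : 0 < e / 2 by rewrite divr_gt0.
  have /cvgrPdist_le/(_ _ e2)/nbhs_ballP[/= h h0 hp] := cf p.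
  exists (ball p (h / 2), [set d | d < h / 2]) => /=.
    split; first by apply/nbhs_ballP; exists (h / 2) => //=; rewrite divr_gt0.
    by apply: nbhs_right_lt; rewrite divr_gt0.
  move=> [x d] /= [px dh] q xq1 xq2.
  have px' : ball p h x by apply: le_ball px; lra.
  have pq : ball p h q.
    case: px => px1 px2; split; rewrite /ball/=.
      rewrite (_ : p.1 - q.1 = (p.1 - x.1) + (x.1 - q.1)); last by ring.
      by rewrite (le_lt_trans (ler_normD _ _))// [ltRHS]splitr ltrD// (le_lt_trans xq1).
    rewrite (_ : p.2 - q.2 = (p.2 - x.2) + (x.2 - q.2)); last by ring.
    by rewrite (le_lt_trans (ler_normD _ _))// [ltRHS]splitr ltrD// (le_lt_trans xq2).
  have := hp _ px'; have := hp _ pq => /= h1 h2.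
  rewrite (_ : g x - g q = (g p - g q) - (g p - g x)); last by ring.
  by rewrite (le_trans (ler_normB _ _))// [leRHS]splitr lerD.
move=> hd.
have [d d0 Kd] : exists2 d, 0 < d & K `<=` P d.
  near (0 : R)^'+ => d; exists d; last by near: d.
  by near: d; exact: nbhs_right_gt.
have Kf p : ~ K p -> g p = 0.
  move=> nKp; apply/eqP/negPn/negP => gp; apply: nKp.
  exact: subset_closure.
exists d => // -[a1 a2] [b1 b2] ab.
have ab1 : `|a1 - b1| <= d by exact: le_trans (Re_le_normc _) ab.
have ab2 : `|a2 - b2| <= d by exact: le_trans (Im_le_normc _) ab.
rewrite -[f (a1 +i* a2)]/(g (a1, a2)) -[f (b1 +i* b2)]/(g (b1, b2)).
have [/Kd h|na] := pselect (K (a1, a2)); first exact: h.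
have [/Kd h|nb] := pselect (K (b1, b2)).
  by rewrite distrC; apply: h => /=; rewrite distrC.
by rewrite (Kf _ na) (Kf _ nb) subrr normr0 ltW.
Unshelve. all: by end_near. Qed.

Lemma Cc_infty_bounded_support (f : R[i] -> R) : Cc_infty f -> bounded_support f.
Proof.
move=> [_ /compact_bounded [M [Mr Mb]]].
exists (2 * (`|M| + 1)) => -[x y] Kz; apply/eqP/negPn/negP => fz.
have M1 : M < `|M| + 1 by rewrite (le_lt_trans (ler_norm _))// ltrDl.
have Kxy : closure [set p : R * R | f (p.1 +i* p.2) != 0] (x, y).
  exact: subset_closure.
have : `|(x, y) : R * R| <= `|M| + 1 by exact: (Mb _ M1 _ Kxy).
rewrite prod_normE/= ge_max => /andP[xM yM].
move: Kz; apply/negP; rewrite -leNgt (le_trans (normc_le_ReIm _))//=.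
by rewrite mulr_natl mulr2n lerD.
Qed.

Lemma measurable_Cc_infty (f : R[i] -> R) :
  Cc_infty f -> measurable_fun [set: R[i]] f.
Proof.
move=> Cf; apply: measurable_unif_cont.
  exact: Cc_infty_unif_cont.
exact: Cc_infty_bounded_support.
Qed.

Lemma Rintegral_uniform_on (s : seq R[i]) (f : R[i] -> R) :
  s != [::] -> measurable_fun [set: R[i]] f ->
  \int[uniform_on s]_z f z = (size s)%:R^-1 * \sum_(a <- s) f a.
Proof.
move=> s0 mf.
have n0 : 0 <= (size s)%:R^-1 :> R by rewrite invr_ge0.
have E (g : R[i] -> R) : measurable_fun [set: R[i]] g -> (forall z, 0 <= g z) ->
    (\int[uniform_on s]_z (g z)%:E = ((size s)%:R^-1 * \sum_(a <- s) g a)%:E)%E.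
  move=> mg g0.
  have mg' : measurable_fun [set: R[i]] (fun z => (g z)%:E) by exact/measurable_EFinP.
  rewrite (@eq_measure_integral _ _ _ _
    (mscale (NngNum n0) (msum (fun k => \d_(nth 0 s k)) (size s)))); last first.
    move=> A mA _; rewrite [LHS](uniform_onE A s0) /mscale/= /msum; congr (_ * _)%E.
    by rewrite (big_nth 0) big_mkord.
  rewrite ge0_integral_mscale// => [|z _]; last by rewrite lee_fin.
  rewrite ge0_integral_measure_sum// => [|z _]; last by rewrite lee_fin.
  rewrite EFinM; congr (_ * _)%E.
  rewrite (big_nth 0) big_mkord -sumEFin; apply: eq_bigr => k _.
  by rewrite integral_dirac// diracT mul1e.
rewrite /Rintegral integralE.
have fp z : ((EFin \o f)^\+ z = (Num.max (f z) 0)%:E)%E.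
  by rewrite funeposE /= EFin_max.
have fn z : ((EFin \o f)^\- z = (Num.max (- f z) 0)%:E)%E.
  by rewrite funenegE /= EFin_max.
rewrite (eq_integral _ _ (fun z _ => fp z)) (eq_integral _ _ (fun z _ => fn z)).
rewrite !E; last 4 first.
- by apply: measurable_maxr => //; exact: measurable_funN.
- by move=> z; rewrite le_max lexx orbT.
- by apply: measurable_maxr.
- by move=> z; rewrite le_max lexx orbT.
rewrite -EFinB/= -mulrBr -sumrB; congr (_ * _); apply: eq_bigr => a _.
by case: (leP (f a) 0) => fa; [rewrite max_l ?oppr_ge0// sub0r opprK|
  rewrite max_r ?subr0// oppr_le0 ltW].
Qed.

End plane_measurability.

(** * Zeros of a product of linear factors and of its derivative *)

Section zeros_of_products.
Context (R : realType).
Implicit Types (s : seq R[i]).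

Lemma zeros_prod_XsubC s : perm_eq (zeros (\prod_(v <- s) ('X - v%:P))) s.
Proof.
apply: prod_XsubC_eq; have := zerosE (\prod_(v <- s) ('X - v%:P)).
by rewrite lead_coef_prod_XsubC scale1r => <-.
Qed.

Lemma lead_deriv_prod_XsubC s : (0 < size s)%N ->
  let p := \prod_(v <- s) ('X - v%:P) in
  size p^`() = size s /\ lead_coef p^`() = (size s)%:R.
Proof.
move=> s0 p; have sp : size p = (size s).+1 by exact: size_prod_XsubC.
have p0 : p != 0 by rewrite -size_poly_eq0 sp.
have cp : p^`()`_(size s).-1 = (size s)%:R.
  rewrite coef_deriv prednK//.
  have : lead_coef p = 1 by rewrite lead_coef_prod_XsubC.
  by rewrite lead_coefE sp => ->.
have sp' : size p^`() = size s.
  apply/eqP; rewrite eqn_leq; apply/andP; split.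
    by rewrite -ltnS -sp lt_size_deriv.
  rewrite leqNgt; apply/negP => h.
  have : p^`()`_(size s).-1 = 0 by apply: nth_default; rewrite -ltnS prednK.
  by rewrite cp => /eqP; rewrite pnatr_eq0 eqn0Ngt s0.
by split=> //; rewrite lead_coefE sp'.
Qed.

Lemma horner_deriv_prod_XsubC s z : z \notin s ->
  (\prod_(v <- s) ('X - v%:P))^`().[z] =
  log_deriv s z * \prod_(v <- s) (z - v).
Proof.
elim: s => [|v s IH]; first by rewrite /log_deriv !big_nil derivC mul0r horner0.
rewrite inE negb_or => /andP[zv zs].
rewrite /log_deriv !big_cons derivM hornerD !hornerM IH// derivXsubC hornerC mul1r.
rewrite !hornerE horner_prod -/(log_deriv s z).
under eq_bigr do rewrite !hornerE.
have key (a b L : R[i]) : a != 0 -> b + a * L * b = (a^-1 + L) * a * b.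
  by move=> a0; field.
by apply: key; rewrite subr_eq0.
Qed.

Lemma zeros_deriv_prod_XsubC s : (0 < size s)%N ->
  let t := zeros (\prod_(v <- s) ('X - v%:P))^`() in
  size s = (size t).+1 /\
  forall z, z \notin s -> (size s)%:R * \prod_(x <- t) (z - x) =
    log_deriv s z * \prod_(v <- s) (z - v).
Proof.
move=> s0 t; have [sp' lp'] := lead_deriv_prod_XsubC s0.
have := zerosE (\prod_(v <- s) ('X - v%:P))^`(); rewrite -/t lp' => E.
split=> [|z zs].
  rewrite -sp' [in LHS]E size_scale ?size_prod_XsubC//.
  by rewrite pnatr_eq0 -lt0n.
rewrite -horner_deriv_prod_XsubC// E hornerZ horner_prod; congr (_ * _).
by apply: eq_bigr => x _; rewrite !hornerE.
Qed.

(** The constant part of [bump] is 1 at each point, and [s] has one point more than [t]: this is the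
    final 1. *)
Lemma sum_bump_dist s (t : seq R[i]) c r D :
  size s = (size t).+1 ->
  `|\sum_(x <- t) log_plus_disc c r x - \sum_(v <- s) log_plus_disc c r v| <= D ->
  `|\sum_(x <- t) log_plus_disc c (2 * r) x -
    \sum_(v <- s) log_plus_disc c (2 * r) v| <= D ->
  `|\sum_(x <- t) bump c r x - \sum_(v <- s) bump c r v| <= 2 * D / ln 2 + 1.
Proof.
have l2 : 0 < ln (2 : R) by rewrite ln_gt0// ltr1n.
have E (u : seq R[i]) : \sum_(x <- u) bump c r x = (size u)%:R -
    (\sum_(x <- u) log_plus_disc c r x) / ln 2 +
    (\sum_(x <- u) log_plus_disc c (2 * r) x) / ln 2.
  rewrite /bump -mulr_suml big_split/= sumrB.
  rewrite big_const_seq count_predT iter_addr_0 -[_ *+ _]mulr_natl.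
  by rewrite !mulrDl mulNr mulfK ?gt_eqF.
rewrite !E => ->; rewrite -[(size t).+1%:R]natr1; move: (\sum_(x <- t) _) (\sum_(v <- s) _).
move=> a b; move: (\sum_(x <- t) _) (\sum_(v <- s) _) => a' b' ab ab'.
rewrite (_ : _ - _ = ((a' - b') - (a - b)) / ln 2 - 1); last by field; rewrite gt_eqF.
rewrite (le_trans (ler_normB _ _))// normr1 lerD2r normrM.
rewrite [X in _ * X]gtr0_norm ?invr_gt0// ler_wpM2r ?invr_ge0 ?(ltW l2)//.
by rewrite mulr_natl mulr2n (le_trans (ler_normB _ _))// lerD.
Qed.

(** From [ln (a n) <= a n] with [a = e / 6], the term [3 ln n] takes half of [e n]; the constants
    take the other half as soon as [n >= B]. *)
Lemma log_affine_bound (e C : R) : 0 < e ->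
  exists n0 : nat, forall n : nat, (n0 <= n)%N -> C + 3 * ln n%:R <= e * n%:R.
Proof.
move=> e0; pose a := e / 6; have a0 : 0 < a by rewrite divr_gt0.
pose B := 2 * (C - 3 * ln a) / e.
exists (Num.truncn B).+1 => n nB.
have nR : (0 : R) < n%:R by rewrite ltr0n (leq_trans _ nB).
have : ln n%:R <= a * n%:R - ln a.
  rewrite lerBrDr addrC -lnM ?posrE// ltW// ln_sublinear// mulr_gt0//.
have Bn : B <= n%:R.
  by rewrite (le_trans (ltW (Num.Theory.truncnS_gt _)))// ler_nat.
move: Bn; rewrite /B ler_pdivrMr// => Bn ln_n.
have : 3 * ln n%:R <= 3 * (a * n%:R - ln a) by rewrite ler_wpM2l.
have -> : 3 * (a * n%:R - ln a) = n%:R * e / 2 - 3 * ln a by rewrite /a; field.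
rewrite [e * _]mulrC; lra.
Qed.

End zeros_of_products.

(** * Anticoncentration of sums of independent variables *)

Section independent_pair.
Context d d' (Omega : measurableType d) (T' : measurableType d') (R : realType).
Variable P : probability Omega R.
Local Open Scope ereal_scope.

(** Under [P] conditioned on [C], the joint law of [(X, S)] agrees with the product of the [P]-laws
    on rectangles, hence everywhere, and Fubini applies. The event [C] is carried along for the
    induction that makes partial sums independent of later variables. *)
Lemma indep_pair_law (X : Omega -> T') (S : Omega -> R) (C : set Omega) :
  measurable_fun setT X -> measurable_fun setT S -> measurable C ->
  (forall A B, measurable A -> measurable B ->
    P (X @^-1` A `&` S @^-1` B `&` C) = P (X @^-1` A) * P (S @^-1` B) * P C) ->
  forall E : set (T' * R), measurable E ->
  P ([set w | E (X w, S w)] `&` C) =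
  (\int[P]_w P [set w' | E (X w, S w')]) * P C.
Proof.
move=> mX mS mC XSC E mE.
have mXS : measurable_fun setT (fun w => (X w, S w)) by exact: measurable_fun_pair.
have mEw : measurable [set w | E (X w, S w)].
  by have := mXS measurableT _ mE; rewrite setTI.
pose X' : {mfun Omega >-> T'} := mfun_Sub (mem_set mX).
pose S' : {mfun Omega >-> R} := mfun_Sub (mem_set mS).
pose XS' : {mfun Omega >-> (T' * R)%type} := mfun_Sub (mem_set mXS).
have [C0|C0] := eqVneq (P C) 0.
  rewrite C0 mule0; apply/eqP; rewrite eq_le measure_ge0 andbT -C0.
  by apply: le_measure; rewrite ?inE//; exact: measurableI.
pose Q := mnormalize (mrestr P mC) P.
have PC : P C \is a fin_num by exact: fin_num_measure.
have QE A : Q A = P (A `&` C) * (fine (P C))^-1%:E.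
  rewrite /Q /mnormalize /= /mrestr /= setTI (negbTE C0)/=.
  by move: PC; rewrite fin_numE => /andP[_ /negbTE ->].
have : (distribution P X' \x distribution P S') E = distribution Q XS' E.
  apply: product_measure_unique => // A B mA mB.
  rewrite [LHS]QE.
  rewrite (_ : (_ @^-1` _) = X @^-1` A `&` S @^-1` B)//.
  rewrite XSC// -muleA -{1}(fineK PC) -EFinM divff ?mule1//.
  by rewrite fine_eq0.
rewrite [X in _ = X]QE => /esym; rewrite /product_measure1.
rewrite ge0_integral_distribution//; last first.
  exact: measurable_fun_xsection.
move=> h; rewrite -[P C in RHS]fineK// muleC.
rewrite (_ : \int[P]_w _ = P ([set w | E (X w, S w)] `&` C) * (fine (P C))^-1%:E).
  rewrite muleCA -EFinM divff ?mule1// fine_eq0//.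
rewrite [RHS]h; apply: eq_integral => w _ /=.
by congr (P _); apply/seteqP; split => w' /=; rewrite /xsection/= inE.
Qed.

End independent_pair.

Section independent_sums.
Context d (Omega : measurableType d) (R : realType) (P : probability Omega R).
Variable X : nat -> {RV P >-> R[i]}.
Hypothesis indepX : mutually_independent P (fun n => X n : Omega -> R[i]).
Variable y : nat -> R[i] -> R.
Hypothesis my : forall n, measurable_fun setT (y n).
Local Open Scope ereal_scope.

Definition partial_sum (n : nat) (w : Omega) : R := (\sum_(j < n) y j (X j w))%R.

Let mX n : measurable_fun setT (X n).
Proof. exact: measurable_funPT. Qed.

Lemma measurable_partial_sum n : measurable_fun setT (partial_sum n).
Proof.
by apply: measurable_sum => j; exact: measurableT_comp (my j) (mX j).
Qed.

Let cap (J : {fset nat}) (B : nat -> set R[i]) : set Omega :=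
  \bigcap_(j in [set` J]) X j @^-1` B j.

Let measurable_preX n A : measurable A -> measurable (X n @^-1` A).
Proof. by move=> mA; have := mX n measurableT mA; rewrite setTI. Qed.

Let measurable_cap J B : (forall j, measurable (B j)) -> measurable (cap J B).
Proof.
move=> mB; apply: fin_bigcap_measurable; first exact: finite_fset.
by move=> j _; exact: measurable_preX.
Qed.

Let cap1U n (J : {fset nat}) A B : n \notin J ->
  X n @^-1` A `&` cap J B = cap (n |` J)%fset (fun j => if j == n then A else B j).
Proof.
move=> nJ; apply/seteqP; split => [w [wA wB] j /=|w h].
  rewrite !inE => /orP[/eqP ->|jJ]; first by rewrite eqxx.
  by case: eqP => [jn|_]; [rewrite jn (negbTE nJ) in jJ|exact: wB].
split; first by have := h n; rewrite /= !inE eqxx; exact.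
move=> j /= jJ; have := h j; rewrite /= !inE jJ orbT => /(_ isT).
by case: eqP => // jn; rewrite -jn jJ in nJ.
Qed.

Let P_capU n (J : {fset nat}) A B : n \notin J -> measurable A ->
  (forall j, measurable (B j)) ->
  P (X n @^-1` A `&` cap J B) = P (X n @^-1` A) * P (cap J B).
Proof.
move=> nJ mA mB; rewrite cap1U// /cap !indepX//; last by move=> j; case: eqP.
rewrite big_fsetU1//= eqxx; congr (_ * _).
rewrite !big_seq; apply: eq_bigr => j jJ; case: eqP => // jn.
by rewrite -jn jJ in nJ.
Qed.

Let cap0 B : cap fset0 B = setT.
Proof. by apply/seteqP; split => // w _ j /=; rewrite inE. Qed.

(** Independence is given for events on single variables only; this extends it to a partial sum
    against events on the variables not yet summed. *)
Let indep_partial_sum n A (J : {fset nat}) B : measurable A ->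
  (forall j, j \in J -> (n <= j)%N) -> (forall j, measurable (B j)) ->
  P (partial_sum n @^-1` A `&` cap J B) = P (partial_sum n @^-1` A) * P (cap J B).
Proof.
elim: n A J B => [|n IH] A J B mA Jn mB.
  have S0 w : partial_sum 0 w = 0%R by rewrite /partial_sum big_ord0.
  have [A0|A0] := pselect (A 0%R).
    rewrite (_ : _ @^-1` A = setT) ?setTI ?probability_setT ?mul1e//.
    by apply/seteqP; split => // w _; rewrite /= S0.
  rewrite (_ : _ @^-1` A = set0) ?set0I ?measure0 ?mul0e//.
  by apply/seteqP; split => // w; rewrite /= S0.
pose E := [set xs : R[i] * R | A (xs.2 + y n xs.1)%R].
have mE : measurable E.
  have mf : measurable_fun setT (fun xs : R[i] * R => xs.2 + y n xs.1)%R.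
    apply: measurable_funD; first exact: measurable_snd.
    exact: measurableT_comp (my n) (measurable_fst).
  by have := mf measurableT _ mA; rewrite setTI.
have SE : partial_sum n.+1 @^-1` A = [set w | E (X n w, partial_sum n w)].
  by apply/seteqP; split => w; rewrite /E/= /partial_sum big_ord_recr.
have nJ : n \notin J by apply/negP => /Jn; rewrite ltnn.
(* The integral does not involve [J']: the case of the empty set identifies it with the probability
   that [partial_sum n.+1] lies in [A], without computing either. *)
have key (J' : {fset nat}) : (forall j, j \in J' -> (n < j)%N) ->
    P (partial_sum n.+1 @^-1` A `&` cap J' B) =
    (\int[P]_w P [set w' | E (X n w, partial_sum n w')]) * P (cap J' B).
  move=> J'n; have nJ' : n \notin J' by apply/negP => /J'n; rewrite ltnn.
  rewrite SE; apply: indep_pair_law => //.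
  - exact: measurable_partial_sum.
  - exact: measurable_cap.
  move=> A' B' mA' mB'.
  rewrite -setIA [_ `&` cap _ _]setIC setIA [X in P X]setIC cap1U// IH//.
  - by rewrite -cap1U// P_capU// muleA [X in X * _]muleC.
  - by move=> j; rewrite !inE => /orP[/eqP ->//|/J'n/ltnW].
  - by move=> j; case: eqP.
rewrite key//; congr (_ * _).
have := key fset0; rewrite cap0 setIT probability_setT mule1 => -> //.
Qed.

Lemma partial_sum_law n (A : set R) : measurable A ->
  P (partial_sum n.+1 @^-1` A) =
  \int[P]_w P [set w' | A (partial_sum n w' + y n (X n w))%R].
Proof.
move=> mA.
pose E := [set xs : R[i] * R | A (xs.2 + y n xs.1)%R].
have mE : measurable E.
  have mf : measurable_fun setT (fun xs : R[i] * R => xs.2 + y n xs.1)%R.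
    apply: measurable_funD; first exact: measurable_snd.
    exact: measurableT_comp (my n) (measurable_fst).
  by have := mf measurableT _ mA; rewrite setTI.
rewrite (_ : _ @^-1` A = [set w | E (X n w, partial_sum n w)] `&` setT).
  rewrite (indep_pair_law (mX n) (measurable_partial_sum n) measurableT)//.
    by rewrite probability_setT mule1.
  move=> A' B' mA' mB'; rewrite setIT probability_setT mule1 setIC.
  have := @indep_partial_sum n B' [fset n]%fset (fun=> A') mB'.
  have -> : cap [fset n]%fset (fun=> A') = X n @^-1` A'.
    rewrite -[RHS]setIT -(cap0 (fun=> A')) cap1U ?inE//.
    by rewrite fsetU0 /cap; apply: eq_bigcapr => j _; case: eqP.
  by move=> ->//; [rewrite muleC|move=> j; rewrite inE => /eqP ->].
by rewrite setIT; apply/seteqP; split => w; rewrite /E/= /partial_sum big_ord_recr.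
Qed.

End independent_sums.

(** * Littlewood-Offord bounds by exchange of intervals *)

Section concentration.
Context d (Omega : measurableType d) (R : realType) (P : probability Omega R).
Implicit Types (xs : seq R) (g : R).

(** Half-open intervals, so that intervals whose left ends are exactly [g] apart are disjoint. *)
Definition interval_union g xs : set R :=
  [set u | has (fun a => (a <= u) && (u < a + g)) xs].

(* The entries are listed in decreasing order. *)
Definition separated g xs := sorted (fun a b => b + g <= a) xs.

Lemma measurable_interval_union g xs : measurable (interval_union g xs).
Proof.
elim: xs => [|a xs IH].
  by rewrite (_ : interval_union g [::] = set0)//; apply/seteqP; split.
rewrite (_ : interval_union _ _ = `[a, (a + g)[ `|` interval_union g xs).
  by apply: measurableU.
apply/seteqP; split => u; rewrite /interval_union/= in_itv/=.
  by move=> /orP.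
by move=> /orP.
Qed.

Lemma interval_union_translate g xs c :
  [set u | interval_union g xs (u + c)] = interval_union g [seq a - c | a <- xs].
Proof.
apply/seteqP; split => u; rewrite /interval_union/= has_map.
  by apply: sub_has => a /= /andP[h1 h2]; apply/andP; split; lra.
by apply: sub_has => a /= /andP[h1 h2]; apply/andP; split; lra.
Qed.

Lemma separated_translate g xs c :
  separated g xs -> separated g [seq a - c | a <- xs].
Proof.
rewrite /separated sorted_map; apply: sub_sorted => a b /=; lra.
Qed.

(* Kleitman's exchange: moving the top interval of the upper translate onto the
   lower translate. *)
Lemma interval_union_exchange (S : Omega -> R) g a xs c1 c2 :
  measurable_fun setT S -> 0 <= g -> c1 + g <= c2 -> separated g (a :: xs) ->
  let hi := [seq b - c1 | b <- a :: xs] in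
  let lo := [seq b - c2 | b <- a :: xs] in
  let mv := a - c1 :: lo in
  separated g mv /\
  (P (S @^-1` interval_union g hi) + P (S @^-1` interval_union g lo) <=
   P (S @^-1` interval_union g mv) +
   P (S @^-1` interval_union g (behead hi)))%E.
Proof.
move=> mS g0 c12 sxs hi lo mv.
have slo : separated g lo by exact: separated_translate.
have shl : separated g mv.
  move: slo; rewrite /separated /mv /lo /= => ->; rewrite andbT; lra.
split=> //.
have mU ys : measurable (S @^-1` interval_union g ys).
  by have := mS measurableT _ (measurable_interval_union g ys); rewrite setTI.
have top : S @^-1` interval_union g mv =
    S @^-1` interval_union g [:: a - c1] `|` S @^-1` interval_union g lo.
  apply/seteqP; split => w; rewrite /interval_union/= orbF.
    by move=> /orP.
  by move=> h; apply/orP.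
have hiU : S @^-1` interval_union g hi =
    S @^-1` interval_union g [:: a - c1] `|` S @^-1` interval_union g (behead hi).
  apply/seteqP; split => w; rewrite /interval_union/= orbF.
    by move=> /orP.
  by move=> h; apply/orP.
have disj : S @^-1` interval_union g [:: a - c1] `&` S @^-1` interval_union g lo = set0.
  apply/seteqP; split => // w [/hasP[_ /[1!inE] /eqP -> /andP[wa _]]].
  move=> /hasP[b blo /andP[_ wb]].
  have tr : transitive (fun a b : R => b + g <= a) by move=> u v t /=; lra.
  have := order_path_min tr shl => /allP /(_ b blo) /=; lra.
rewrite [in leRHS]top measureU// hiU [leRHS]addeAC leeD2r//.
exact: measureU2.
Qed.

(** All numbers of intervals up to [K] are followed at once: the exchange trades two unions of [k]
    intervals for one of [k + 1] and one of [k - 1], so a bound for one interval alone cannot be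
    carried through an induction. *)
Definition concentrated (S : Omega -> R) g (K : nat) (q : nat -> R) :=
  forall xs, separated g xs -> (size xs <= K)%N ->
  (P (S @^-1` interval_union g xs) <= (q (size xs))%:E)%E.

End concentration.

Section survival_bound.
Context (R : realType).

(* An upper bound, when [k <= K], for the probability that a lazy simple random
   walk started at [k], moving with probability [p] at each of [M] steps, avoids
   [0]: it has reached [K] first, or it has stayed in the open interval. *)
Definition survival_bound (K : nat) (p : R) (M k : nat) : R :=
  k%:R / K%:R + (1 - p / K%:R ^+ 2) ^+ M * (k%:R * (K%:R - k%:R)).

Variables (K : nat) (p : R).
Hypotheses (K0 : (0 < K)%N) (p0 : 0 <= p) (p1 : p <= 1).
Let KR : (0 : R) < K%:R. Proof. by rewrite ltr0n. Qed.
Let rho : R := 1 - p / K%:R ^+ 2.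

Let K1 : (1 : R) <= K%:R ^+ 2.
Proof. by rewrite exprn_ege1// ler1n. Qed.

Let rho0 : 0 <= rho.
Proof.
by rewrite subr_ge0 ler_pdivrMr ?exprn_gt0// mul1r (le_trans p1).
Qed.

Lemma survival_bound_ge0 M k : (k <= K)%N -> 0 <= survival_bound K p M k.
Proof.
move=> kK; rewrite addr_ge0 ?divr_ge0// mulr_ge0 ?exprn_ge0// mulr_ge0//.
by rewrite subr_ge0 ler_nat.
Qed.

Lemma survival_bound0 M : survival_bound K p M 0 = 0.
Proof. by rewrite /survival_bound !mul0r mulr0 addr0. Qed.

Lemma survival_boundK M : survival_bound K p M K = 1.
Proof. by rewrite /survival_bound subrr !mulr0 addr0 divff// gt_eqF. Qed.

Lemma survival_bound_start k : (0 < k <= K)%N -> 1 <= survival_bound K p 0 k.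
Proof.
move=> /andP[k0]; rewrite leq_eqVlt => /orP[/eqP ->|kK].
  by rewrite survival_boundK.
rewrite /survival_bound mul1r -natrB 1?ltnW// -natrM ler_wpDl ?divr_ge0//.
by rewrite ler1n muln_gt0 k0 subn_gt0.
Qed.

(** The part [k / K] is harmonic, and [k (K - k)] has second difference -2. *)
Lemma survival_bound_step M k : (0 < k)%N ->
  survival_bound K p M k.+1 + survival_bound K p M k.-1 =
  2 * survival_bound K p M k - 2 * rho ^+ M.
Proof.
case: k => // k _; rewrite /survival_bound -/rho/= -!natr1.
by move: (rho ^+ M) => x; field; rewrite gt_eqF.
Qed.

Lemma survival_bound_concave M k : (0 < k)%N ->
  survival_bound K p M k.+1 + survival_bound K p M k.-1 <=
  2 * survival_bound K p M k.
Proof.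
move=> k0; rewrite survival_bound_step// gerBl mulr_ge0//.
by rewrite exprn_ge0.
Qed.

(** A lazy step lowers the parabola [k (K - k)] by [p], which is at least the fraction [p / K ^ 2]
    of it since [k (K - k) <= K ^ 2]. *)
Lemma survival_bound_lazy M k : (0 < k <= K)%N ->
  p * ((survival_bound K p M k.+1 + survival_bound K p M k.-1) / 2) +
  (1 - p) * survival_bound K p M k <= survival_bound K p M.+1 k.
Proof.
move=> /andP[k0 kK]; rewrite survival_bound_step//.
rewrite [leLHS](_ : _ = survival_bound K p M k - p * rho ^+ M); last by field.
rewrite /survival_bound -/rho exprS -subr_ge0.
set f := k%:R * (K%:R - k%:R).
rewrite [X in 0 <= X](_ : _ = rho ^+ M * p * (1 - f / K%:R ^+ 2)); last first.
  by rewrite /rho; move: (_ ^+ M) => x; field; rewrite gt_eqF.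
rewrite !mulr_ge0 ?exprn_ge0// subr_ge0 ler_pdivrMr ?exprn_gt0// mul1r.
by rewrite expr2 /f ler_pM ?subr_ge0 ?ler_nat// lerBlDr lerDl.
Qed.

End survival_bound.

(** First [K] makes the chance [1 / K] of reaching [K] at most [eta / 2]; then the number of steps
    makes the chance of staying inside as small. *)
Lemma survival_bound_small (R : realType) (p eta : R) : 0 < p -> p <= 1 -> 0 < eta ->
  exists K m, (1 < K)%N /\
    forall M, (m <= M)%N -> survival_bound K p M 1 <= eta.
Proof.
move=> p0 p1 eta0.
pose K := (Num.truncn (2 / eta)).+2.
have Ke : 2 / eta < K%:R.
  apply: lt_trans (Num.Theory.truncnS_gt _) _.
  by rewrite ltr_nat ltnS leqnn.
have KR : (0 : R) < K%:R by rewrite ltr0n.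
have K2 : (1 : R) <= K%:R ^+ 2 by rewrite exprn_ege1// ler1n.
pose rho : R := 1 - p / K%:R ^+ 2.
have pK0 : 0 < p / K%:R ^+ 2 by rewrite divr_gt0// exprn_gt0.
have pK1 : p / K%:R ^+ 2 <= 1.
  by rewrite ler_pdivrMr ?exprn_gt0// mul1r (le_trans p1).
have rho0 : 0 <= rho by rewrite subr_ge0.
have rho1 : rho < 1 by rewrite gtrBl.
have e0 : 0 < eta / 2 / K%:R by rewrite !divr_gt0.
have : (fun k => rho ^+ k) @ \oo --> (0 : R).
  by apply: cvg_expr; rewrite ger0_norm.
move/cvgrPdist_le => /(_ _ e0) [m _ mh].
exists K, m; split=> // M mM; have := mh M mM.
rewrite sub0r normrN ger0_norm ?exprn_ge0// ler_pdivlMr// => h.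
rewrite /survival_bound -/rho [leRHS]splitr lerD//.
  rewrite ler_pdivrMr// mulrC mulrA -[X in X <= _]/(1%:R).
  move: Ke; rewrite ltr_pdivrMr// => /ltW Ke.
  by rewrite ler_pdivlMr// mul1r.
apply: le_trans h; rewrite ler_wpM2l ?exprn_ge0// mul1r.
by rewrite gerBl ler0n.
Qed.

Lemma measurable_oppc (R : realType) : measurable_fun setT (fun z : R[i] => - z).
Proof.
move=> _ Y mY; rewrite setTI; apply/measurable_complexE.
have mf : measurable_fun [set: R * R] (fun p => (- p.1, - p.2)).
  by apply: measurable_fun_pair; apply: measurable_funN;
    [exact: measurable_fst|exact: measurable_snd].
have /measurable_complexE mY' := mY.
by have := mf measurableT _ mY'; rewrite setTI.
Qed.

Section anticoncentration.
Context d (Omega : measurableType d) (R : realType) (P : probability Omega R).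
Variable X : nat -> {RV P >-> R[i]}.
Hypothesis indepX : mutually_independent P (fun n => X n : Omega -> R[i]).
Hypothesis symX : forall n, eq_distribution P (X n) (fun w => - X n w).
Variable y : nat -> R[i] -> R.
Hypothesis my : forall n, measurable_fun setT (y n).
Local Notation S := (partial_sum X y).

Let mX n : measurable_fun setT (X n).
Proof. exact: measurable_funPT. Qed.

Let mNX n : measurable_fun setT (fun w => - X n w).
Proof. exact: measurableT_comp (@measurable_oppc R) (mX n). Qed.

Lemma symmetric_integral n (phi : R[i] -> \bar R) :
  measurable_fun setT phi -> (forall x, 0 <= phi x)%E ->
  (\int[P]_w phi (X n w) = \int[P]_w phi (- X n w)%R)%E.
Proof.
move=> mphi phi0.
pose NX : {mfun Omega >-> R[i]} := mfun_Sub (mem_set (mNX n)).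
have := ge0_integral_distribution (X n) mphi phi0.
have := ge0_integral_distribution (P := P) NX mphi phi0.
rewrite /comp/= => <- <-; apply: eq_measure_integral => A mA _.
exact: symX.
Qed.

Definition gap_event n g : set Omega :=
  [set w | g <= `|y n (X n w) - y n (- X n w)|].

(** Given [X n], the new sum meets [interval_union g xs] when the old one meets a translate of it.
    Averaging over [X n] and [- X n] produces two translates: on the gap event they are at least [g]
    apart and can be exchanged, elsewhere each is bounded by [q k]. *)
Lemma concentrated_step n g K q p xs : 0 <= g -> p <= 1 ->
  (forall k, (k <= K)%N -> 0 <= q k) ->
  concentrated P (S n) g K q ->
  (p%:E <= P (gap_event n g))%E ->
  separated g xs -> (0 < size xs < K)%N ->
  q (size xs).+1 + q (size xs).-1 <= 2 * q (size xs) ->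
  (P (S n.+1 @^-1` interval_union g xs) <=
   (p * ((q (size xs).+1 + q (size xs).-1) / 2) + (1 - p) * q (size xs))%:E)%E.
Proof.
move=> g0 p1 q0 conc pG sxs /andP[k0 kK] qk.
set k := size xs in k0 kK qk *; set G := gap_event n g in pG.
pose a := q k.+1 + q k.-1; pose b := 2 * q k.
have a0 : 0 <= a by rewrite addr_ge0 ?q0// (leq_trans (leq_pred _))// ltnW.
have mS := measurable_partial_sum X my n.
pose phi x : \bar R := P [set w | interval_union g xs (S n w + y n x)].
have phiE x : phi x = P (S n @^-1` interval_union g [seq u - y n x | u <- xs]).
  by rewrite -interval_union_translate.
have phi0 x : (0 <= phi x)%E.
  by rewrite /phi measure_ge0.
have mphi : measurable_fun setT phi.
  pose S' : {mfun Omega >-> R} := mfun_Sub (mem_set mS).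
  pose E := [set zs : R[i] * R | interval_union g xs (zs.2 + y n zs.1)].
  have mE : measurable E.
    have mf : measurable_fun setT (fun zs : R[i] * R => zs.2 + y n zs.1)%R.
      apply: measurable_funD; first exact: measurable_snd.
      exact: measurableT_comp (my n) (measurable_fst).
    by have := mf measurableT _ (measurable_interval_union g xs); rewrite setTI.
  rewrite (_ : phi = distribution P S' \o xsection E).
    exact: measurable_fun_xsection.
  apply/funext => x /=; congr (P _).
  by apply/seteqP; split => w /=; rewrite /xsection/= inE.
have mG : measurable G.
  have mf : measurable_fun setT (fun w => `|y n (X n w) - y n (- X n w)|).
    apply: measurableT_comp => //; apply: measurable_funB.
      exact: measurableT_comp (my n) (mX n).
    exact: measurableT_comp (my n) (mNX n).
  have := mf measurableT _ (measurable_itv `[g, +oo[); rewrite setTI.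
  by rewrite (_ : _ @^-1` _ = G)//; apply/seteqP; split => w; rewrite /G/gap_event/= in_itv/= andbT.
have phiq x : (phi x <= (q k)%:E)%E.
  rewrite phiE; have := conc [seq u - y n x | u <- xs] (separated_translate _ sxs).
  by rewrite size_map; apply; exact: ltnW.
have exch x1 x2 : y n x1 + g <= y n x2 -> (phi x1 + phi x2 <= a%:E)%E.
  move=> y12; rewrite !phiE.
  case E : xs sxs => [|c ys] sxs; first by move: k0; rewrite /k E.
  have kE : k = (size ys).+1 by rewrite /k E.
  have [shl le1] := interval_union_exchange P mS g0 y12 sxs.
  apply: le_trans le1 _; rewrite EFinD leeD//.
    have := conc _ shl; rewrite kE /= size_map; apply.
    by move: kK; rewrite kE.
  have := conc (behead [seq b - y n x1 | b <- c :: ys]).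
  rewrite kE /= size_map; apply.
    by have := separated_translate (y n x1) sxs; exact: path_sorted.
  by move: kK; rewrite kE => /ltnW/ltnW.
have pair w : (phi (X n w) + phi (- X n w)%R <= (a + (b - a) * \1_(~` G) w)%:E)%E.
  have [Gw|Gw] := pselect (G w).
    rewrite indicE memNset ?mulr0 ?addr0; last by move/(_ Gw).
    move: (Gw); rewrite /G/gap_event/= ler_normr => /orP[h|h].
      by rewrite addeC; apply: exch; lra.
    by apply: exch; lra.
  have ab : a + (b - a) * 1 = q k + q k by rewrite /b; ring.
  rewrite indicE mem_set// ab EFinD.
  by rewrite leeD.
(* Concavity of [q] at [k] means [b - a >= 0], so that the probability of the complement of [G] may
   be replaced by its upper bound [1 - p]. *)
have two : (2%:E * P (S n.+1 @^-1` interval_union g xs) <= (a + (b - a) * (1 - p))%:E)%E.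
  rewrite (partial_sum_law indepX my n (measurable_interval_union g xs)).
  rewrite -[X in (_ * X)%E]/(\int[P]_w phi (X n w))%E.
  rewrite (_ : 2%:E * _ = \int[P]_w phi (X n w) + \int[P]_w phi (- X n w)%R)%E; last first.
    by rewrite -symmetric_integral// -[2]/(1 + 1) EFinD ge0_muleDl// !mul1e.
  rewrite -ge0_integralD//; last 2 first.
    - exact: measurableT_comp mphi (mX n).
    - exact: measurableT_comp mphi (mNX n).
  apply: (@le_trans _ _ (\int[P]_w (a + (b - a) * \1_(~` G) w)%:E)%E).
    apply: ge0_le_integral => //.
    - by move=> w _; rewrite adde_ge0.
    - apply: emeasurable_funD.
        exact: measurableT_comp mphi (mX n).
      exact: measurableT_comp mphi (mNX n).
    - apply/measurable_EFinP; apply: measurable_funD => //.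
      apply: measurable_funM => //; apply: measurable_indic.
      exact: measurableC.
  under eq_integral do rewrite EFinD EFinM.
  rewrite ge0_integralD//; last 2 first.
    - by move=> w _; rewrite mule_ge0// lee_fin ?subr_ge0.
    - apply: emeasurable_funM => //; apply/measurable_EFinP; apply: measurable_indic.
      exact: measurableC.
  rewrite integral_cst// [X in (_ * X + _)%E](_ : _ = 1%E) ?mule1; last exact: probability_setT.
  rewrite ge0_integralZl//; last 2 first.
    - apply/measurable_EFinP; apply: measurable_indic; exact: measurableC.
    - by rewrite lee_fin subr_ge0.
  rewrite integral_indic ?setIT//; last exact: measurableC.
  rewrite [leRHS]EFinD leeD2l// EFinM lee_wpmul2l ?lee_fin ?subr_ge0//.
  by rewrite [leLHS](probability_setC P mG) EFinB; exact: leeB.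
move: two; have PS : P (S n.+1 @^-1` interval_union g xs) \is a fin_num.
  apply: fin_num_measure.
  have := measurable_partial_sum X my n.+1.
  by move=> /(_ measurableT _ (measurable_interval_union g xs)); rewrite setTI.
rewrite -(fineK PS) -EFinM !lee_fin => two.
rewrite -/a -/b in two *; rewrite /b in two; lra.
Qed.

End anticoncentration.

Section anticoncentration_sums.
Context d (Omega : measurableType d) (R : realType) (P : probability Omega R).
Variable X : nat -> {RV P >-> R[i]}.
Hypothesis indepX : mutually_independent P (fun n => X n : Omega -> R[i]).
Hypothesis symX : forall n, eq_distribution P (X n) (fun w => - X n w).

(** The number of intervals plays the role of the position of the walk: no interval has probability
    0, [K] intervals have the trivial bound 1. Only the indices in [act] count as steps; the others
    are handled by [concentrated_step] with [p = 0]. *)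
Lemma partial_sum_concentrated (y : nat -> R[i] -> R) (act : nat -> bool)
    (g p : R) (K n : nat) :
  (forall j, measurable_fun setT (y j)) ->
  0 <= g -> 0 <= p -> p <= 1 -> (0 < K)%N ->
  (forall j, act j -> (p%:E <= P (gap_event X y j g))%E) ->
  concentrated P (partial_sum X y n) g K
    (survival_bound K p (\sum_(j < n) act j)).
Proof.
move=> my g0 p0 p1 K0 actP; elim: n => [|n IH] xs sxs.
  case: xs sxs => [|a xs] sxs sK.
    rewrite survival_bound0 (_ : _ @^-1` _ = set0) ?measure0//.
    by apply/seteqP; split.
  apply: le_trans (probability_le1 _ _) _.
    have := measurable_partial_sum X my 0.
    by move=> /(_ measurableT _ (measurable_interval_union g (a :: xs))); rewrite setTI.
  by rewrite lee_fin big_ord0 survival_bound_start.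
have mI : measurable (partial_sum X y n.+1 @^-1` interval_union g xs).
  have := measurable_partial_sum X my n.+1.
  by move=> /(_ measurableT _ (measurable_interval_union g xs)); rewrite setTI.
rewrite leq_eqVlt => /orP[/eqP ->|sK].
  by rewrite survival_boundK// probability_le1.
have [x0|x0] := posnP (size xs).
  rewrite x0 survival_bound0 (_ : _ @^-1` _ = set0) ?measure0//.
  by case: xs {sxs mI sK} x0 => // _; apply/seteqP; split.
have q0 k : (k <= K)%N -> 0 <= survival_bound K p (\sum_(j < n) act j) k.
  exact: survival_bound_ge0.
have qc := survival_bound_concave K0 p1 (\sum_(j < n) act j) x0.
have x0K : (0 < size xs < K)%N by rewrite x0.
rewrite big_ord_recr/=; case actn : (act n).
  have := concentrated_step indepX symX my g0 p1 q0 IH (actP _ actn) sxs x0K qc.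
  move/le_trans; apply; rewrite lee_fin addn1 survival_bound_lazy//.
  by rewrite x0 ltnW.
have := concentrated_step indepX symX my g0 ler01 q0 IH _ sxs x0K qc.
rewrite mul0r add0r subr0 mul1r addn0; apply.
exact: measure_ge0.
Qed.

(** What matters is that [m] depends on [p] and [eta] only, and so is common to all [z] once the
    functions [y] are resolvents at [z]. *)
Lemma partial_sum_anticoncentration (p eta : R) :
  0 < p -> p <= 1 -> 0 < eta -> exists m : nat,
  forall (y : nat -> R[i] -> R) (act : nat -> bool) (g x : R) (n : nat),
  (forall j, measurable_fun setT (y j)) -> 0 <= g ->
  (forall j, act j -> (p%:E <= P (gap_event X y j g))%E) ->
  (m <= \sum_(j < n) act j)%N ->
  (P (partial_sum X y n @^-1` interval_union g [:: x]) <= eta%:E)%E.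
Proof.
move=> p0 p1 eta0; have [K [m [K1 Km]]] := survival_bound_small p0 p1 eta0.
exists m => y act g x n my g0 actP mn.
have K0 : (0 < K)%N by exact: ltnW.
have conc := partial_sum_concentrated n my g0 (ltW p0) p1 K0 actP.
apply: le_trans (conc [:: x] isT _) _ => //.
by rewrite lee_fin Km.
Qed.

End anticoncentration_sums.

(** * Effect of a sign change on a resolvent term *)

Section resolvent_gap.
Context (R : realType).

(* Also when [a = b] or [a = - b], with the convention [0^-1 = 0]. *)
Lemma normc_sub_inv_ge (a b : R[i]) : b != 0 ->
  2 * normc b / (normc a + normc b) ^+ 2 <= normc ((a - b)^-1 - (a + b)^-1).
Proof.
move=> b0; have nb : 0 < normc b by rewrite normc_gt0.
have nab : 0 < normc a + normc b by rewrite ltr_wpDl ?normc_ge0.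
have two : normc (2%:R * b) = 2 * normc b by rewrite normcM normc_nat.
have deg : normc a = normc b ->
    2 * normc b / (normc a + normc b) ^+ 2 = (2 * normc b)^-1.
  move=> ->; have -> : normc b + normc b = 2 * normc b by ring.
  rewrite expr2 invfM.
  by rewrite mulrA divff ?mul1r// mulf_neq0// gt_eqF.
have [ab|ab] := eqVneq (a - b) 0.
  have E : a = b by apply/eqP; rewrite -subr_eq0 ab.
  rewrite ab invr0 sub0r normcN normcV deg ?E//.
  by rewrite (_ : b + b = 2%:R * b) ?two//; ring.
have [ab'|ab'] := eqVneq (a + b) 0.
  have E : a = - b by apply/eqP; rewrite -addr_eq0 ab'.
  rewrite ab' invr0 subr0 normcV deg ?E ?normcN//.
  by rewrite (_ : - b - b = - (2%:R * b)) ?normcN ?two//; ring.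
rewrite -[(a - b)^-1]div1r -[(a + b)^-1]div1r -mulNr addf_div//.
have -> : 1 * (a + b) + -1 * (a - b) = 2%:R * b by ring.
rewrite normcM two normcV normcM ler_wpM2l ?mulr_ge0 ?(ltW nb)//.
rewrite lef_pV2 ?posrE ?exprn_gt0 ?mulr_gt0 ?normc_gt0//.
rewrite expr2 ler_pM ?normc_ge0 ?le_normcD//.
by rewrite (le_trans (le_normcD _ _))// normcN.
Qed.

(** The inverse is discontinuous at 0; writing it as a sign times a power of the modulus respects
    [0^-1 = 0], the sign being 0 there. *)
Lemma measurable_inv_real : measurable_fun [set: R] (fun x => x^-1).
Proof.
rewrite (_ : (fun x : R => x^-1) = (fun x => Num.sg x * (`|x| `^ (-1)))).
  apply: measurable_funM; last first.
    apply: (@measurableT_comp _ _ _ _ _ _ (fun x : R => x `^ (-1))).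
      exact: measurable_powR.
    exact: normr_measurable.
  rewrite (_ : Num.sg = (fun x : R => \1_(`]0, +oo[) x - \1_(`]-oo, 0[) x)).
    by apply: measurable_funB; apply: measurable_indic.
  apply/funext => x; rewrite !indicE; case: (ltgtP x 0) => x0.
  - rewrite ltr0_sg// memNset ?mem_set ?sub0r//= in_itv/= ?andbT//.
    by apply/negP; rewrite -leNgt ltW.
  - rewrite gtr0_sg// mem_set ?memNset ?subr0//= in_itv/= ?andbT//.
    by apply/negP; rewrite -leNgt ltW.
  - by rewrite x0 sgr0 !memNset ?subr0//= in_itv/= ?andbT ltxx.
apply/funext => x; rewrite powR_inv1//; case: (ltgtP x 0) => x0.
- by rewrite ltr0_sg// ltr0_norm// invrN mulN1r opprK.
- by rewrite gtr0_sg// gtr0_norm// mul1r.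
- by rewrite x0 invr0 sgr0 mul0r.
Qed.

Let measurable_affine (z c : R[i]) (s : R) :
  measurable_fun setT (fun x : R[i] => complex.Re (z - (c + s%:C * x))) /\
  measurable_fun setT (fun x : R[i] => complex.Im (z - (c + s%:C * x))).
Proof.
split.
  rewrite (_ : (fun _ => _) = (fun x : R[i] =>
      complex.Re z - (complex.Re c + s * complex.Re x))).
    apply: measurable_funB => //; apply: measurable_funD => //.
    by apply: measurable_funM => //; exact: measurable_Re.
  by apply/funext => -[a b]; case: z; case: c => /= *; ring.
rewrite (_ : (fun _ => _) = (fun x : R[i] =>
    complex.Im z - (complex.Im c + s * complex.Im x))).
  apply: measurable_funB => //; apply: measurable_funD => //.
  by apply: measurable_funM => //; exact: measurable_Im.
by apply/funext => -[a b]; case: z; case: c => /= *; ring.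
Qed.

Lemma measurable_Re_resolvent (z c : R[i]) (s : R) :
  measurable_fun setT (fun x : R[i] => complex.Re (z - (c + s%:C * x))^-1).
Proof.
have [mre mim] := measurable_affine z c s.
pose re x := complex.Re (z - (c + s%:C * x)).
pose im x := complex.Im (z - (c + s%:C * x)).
rewrite (_ : (fun _ => _) = (fun x => re x * (re x ^+ 2 + im x ^+ 2)^-1)).
  apply: measurable_funM => //; apply: measurableT_comp measurable_inv_real _.
  by apply: measurable_funD; apply: measurable_funX.
by apply/funext => x; rewrite /re /im; case: (z - _).
Qed.

Lemma measurable_Im_resolvent (z c : R[i]) (s : R) :
  measurable_fun setT (fun x : R[i] => complex.Im (z - (c + s%:C * x))^-1).
Proof.
have [mre mim] := measurable_affine z c s.
pose re x := complex.Re (z - (c + s%:C * x)).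
pose im x := complex.Im (z - (c + s%:C * x)).
rewrite (_ : (fun _ => _) = (fun x => - (im x * (re x ^+ 2 + im x ^+ 2)^-1))).
  apply: measurable_funN; apply: measurable_funM => //.
  apply: measurableT_comp measurable_inv_real _.
  by apply: measurable_funD; apply: measurable_funX.
by apply/funext => x; rewrite /re /im; case: (z - _).
Qed.

End resolvent_gap.

Section perturbed_points.
Context d (Omega : measurableType d) (R : realType) (P : probability Omega R).
Variables (u : nat -> R[i]) (X : nat -> {RV P >-> R[i]}) (sigma : nat -> R).
Hypothesis indepX : mutually_independent P (fun n => X n : Omega -> R[i]).
Hypothesis identX : forall n, eq_distribution P (X n) (X 0%N).
Hypothesis nondegX : ~ {ae P, forall w, X 0%N w = 0}.
Hypothesis symX : forall n, eq_distribution P (X n) (fun w => - X n w).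
Hypothesis sigma_gt0 : forall n, 0 < sigma n.

Definition perturbed_points (n : nat) (w : Omega) : seq R[i] :=
  mkseq (fun k => u k + (sigma k)%:C * X k w) n.

Definition annulus (a b : R) : set R[i] := [set z | a <= normc z <= b].

Lemma measurable_annulus a b : measurable (annulus a b).
Proof.
have := measurable_normc_sub (0 : R[i]) measurableT (measurable_itv `[a, b]).
rewrite setTI (_ : _ @^-1` _ = annulus a b)//.
by apply/seteqP; split => z; rewrite /annulus/= in_itv/= subr0.
Qed.

(** The annuli of radii [1 / (k + 1)] and [k + 1] exhaust the nonzero numbers, so one of them has
    positive probability. It is split into [p + p] because a sign change is later visible either in
    a real or in an imaginary part. *)
Lemma nondegenerate_annulus : exists a b p : R,
  [/\ 0 < a, 0 < p, p <= 1 &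
    forall n, ((p + p)%:E <= P (X n @^-1` annulus a b))%E].
Proof.
pose A k := X 0%N @^-1` annulus k.+1%:R^-1 k.+1%:R.
have mA k : measurable (A k).
  have := measurable_funPT (X 0%N) measurableT _ (measurable_annulus k.+1%:R^-1 k.+1%:R).
  by rewrite setTI.
have [[k Ak]|A0] := pselect (exists k, P (A k) != 0).
  have Akf : P (A k) \is a fin_num by exact: fin_num_measure.
  have Ak0 : 0 < fine (P (A k)) by rewrite fine_gt0// lt0e Ak measure_ge0 ltey_eq Akf.
  have Ak1 : fine (P (A k)) <= 1.
    by rewrite -lee_fin fineK// probability_le1.
  exists k.+1%:R^-1, k.+1%:R, (fine (P (A k)) / 2); split.
  - by rewrite invr_gt0.
  - by rewrite divr_gt0.
  - lra.
  move=> n; rewrite (identX n (measurable_annulus _ _)).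
  rewrite -splitr fineK//; exact: lexx.
exfalso; apply: nondegX.
have nA : P.-negligible (\bigcup_k A k).
  apply: negligible_bigcup => k; exists (A k); split=> //.
  by apply/eqP/negPn/negP => Ak; apply: A0; exists k.
apply: negligibleS nA.
move=> w /= /eqP X0; have nX : 0 < normc (X 0%N w) by rewrite normc_gt0.
pose k := Num.truncn (Num.max (normc (X 0%N w)) (normc (X 0%N w))^-1).
have := Num.Theory.truncnS_gt (Num.max (normc (X 0%N w)) (normc (X 0%N w))^-1).
rewrite -/k gt_max => /andP[h1 h2].
exists k => //; rewrite /A /annulus/=; apply/andP; split; last exact: ltW.
by rewrite -[leRHS]invrK lef_pV2 ?posrE ?invr_gt0// ltW.
Qed.

Definition re_resolvent (z : R[i]) (j : nat) (x : R[i]) : R :=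
  complex.Re (z - (u j + (sigma j)%:C * x))^-1.

Definition im_resolvent (z : R[i]) (j : nat) (x : R[i]) : R :=
  complex.Im (z - (u j + (sigma j)%:C * x))^-1.

Lemma log_deriv_perturbed n w z :
  log_deriv (perturbed_points n w) z =
  partial_sum X (re_resolvent z) n w +i* partial_sum X (im_resolvent z) n w.
Proof.
rewrite /log_deriv /perturbed_points big_mkseq.
rewrite /partial_sum; elim: n => [|n IH]; first by rewrite !big_ord0.
rewrite !big_ord_recr/= IH /re_resolvent /im_resolvent.
by case: (_^-1) => a b.
Qed.

(** A minimum over finitely many [j], each with its own bound from [normc_sub_inv_ge], uniform in
    the disc [|z| <= K]. The factor 2 ensures that one of the two parts moves by at least [g]. *)
Lemma resolvent_gap (K a b : R) (m : nat) : 0 < a -> exists2 g, 0 < g &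
  forall z j x, (j < m)%N -> normc z <= K -> annulus a b x ->
    2 * g <= `|re_resolvent z j x - re_resolvent z j (- x)| +
             `|im_resolvent z j x - im_resolvent z j (- x)|.
Proof.
move=> a0.
pose G j : R := sigma j * a / (`|K| + normc (u j) + sigma j * `|b| + 1) ^+ 2.
have den0 j : 0 < `|K| + normc (u j) + sigma j * `|b| + 1.
  by rewrite ltr_wpDl// !addr_ge0 ?normc_ge0// mulr_ge0// ltW.
have G0 j : 0 < G j by rewrite divr_gt0 ?mulr_gt0// exprn_gt0.
exists (\big[Num.min/1]_(j < m) G j).
  by elim/big_ind: _ => // x y x0 y0; rewrite lt_min x0.
move=> z j x jm zK /andP[ax xb].
have nx : 0 < normc x by exact: lt_le_trans ax.
have sx0 : (sigma j)%:C * x != 0.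
  by rewrite -normc_gt0 normcM normc_real gtr0_norm// mulr_gt0.
have := normc_sub_inv_ge (z - u j) sx0.
set r1 := (_ - _)^-1; set r2 := (_ + _)^-1 => gap.
have -> : re_resolvent z j x - re_resolvent z j (- x) = complex.Re (r1 - r2).
  rewrite /re_resolvent mulrN !opprD opprK !addrA -/r1 -/r2.
  by case: (r1) => ? ?; case: (r2).
have -> : im_resolvent z j x - im_resolvent z j (- x) = complex.Im (r1 - r2).
  rewrite /im_resolvent mulrN !opprD opprK !addrA -/r1 -/r2.
  by case: (r1) => ? ?; case: (r2).
apply: le_trans (normc_le_ReIm _); apply: le_trans gap.
have minG : \big[Num.min/1]_(i < m) G i <= G j.
  by rewrite (bigminD1 (Ordinal jm))//= ge_min lexx.
apply: (@le_trans _ _ (2 * G j)); first by rewrite ler_wpM2l.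
rewrite -mulrA ler_wpM2l// /G normcM normc_real (gtr0_norm (sigma_gt0 j)).
have sj := sigma_gt0 j.
apply: ler_pM.
- by rewrite mulr_ge0 // ltW.
- by rewrite invr_ge0 sqr_ge0.
- by rewrite ler_wpM2l// ltW.
have d0 : 0 < normc (z - u j) + sigma j * normc x.
  by rewrite ltr_wpDl ?normc_ge0 ?mulr_gt0.
rewrite lef_pV2 ?posrE ?exprn_gt0// lerXn2r ?nnegrE ?(ltW d0) ?(ltW (den0 j))//.
apply: ler_wpDr => //; apply: lerD.
  rewrite (le_trans (le_normcD _ _))// normcN lerD2r (le_trans zK)//.
  exact: ler_norm.
by rewrite ler_wpM2l ?(ltW sj)// (le_trans xb)// ler_norm.
Qed.

(** Both [delta] and [m] come before [n] and [z]; only the exceptional event varies with them. *)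
Lemma log_deriv_anticoncentration (K eta : R) : 0 < eta ->
  exists (delta : R) (m : nat), 0 < delta /\
  forall n z, (m <= n)%N -> normc z <= K ->
  exists A : set Omega, [/\ measurable A, (P A <= eta%:E)%E &
    forall w, ~ A w -> delta <= normc (log_deriv (perturbed_points n w) z)].
Proof.
move=> eta0; have [a [b [p [a0 p0 p1 pA]]]] := nondegenerate_annulus.
have [m0 anti] := partial_sum_anticoncentration indepX symX p0 p1 eta0.
(* Each [j < m] is active for the real or for the imaginary part, so one of the two parts has at
   least [m0] active indices; which one may depend on [z]. *)
pose m := (m0 + m0)%N.
have [g g0 gap] := resolvent_gap K b m a0.
exists (g / 2), m; split; first by rewrite divr_gt0.
move=> n z mn zK.
pose act (y : nat -> R[i] -> R) j := `[< (p%:E <= P (gap_event X y j g))%E >].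
have mre j : measurable_fun setT (re_resolvent z j) by exact: measurable_Re_resolvent.
have mim j : measurable_fun setT (im_resolvent z j) by exact: measurable_Im_resolvent.
have mgap (y : nat -> R[i] -> R) j : (forall i, measurable_fun setT (y i)) ->
    measurable (gap_event X y j g).
  move=> my; have mf : measurable_fun setT (fun w => `|y j (X j w) - y j (- X j w)|).
    apply: measurableT_comp => //; apply: measurable_funB.
      exact: measurableT_comp (my j) (measurable_funPT (X j)).
    apply: measurableT_comp (my j) _.
    exact: measurableT_comp (@measurable_oppc R) (measurable_funPT (X j)).
  have := mf measurableT _ (measurable_itv `[g, +oo[); rewrite setTI.
  rewrite (_ : _ @^-1` _ = gap_event X y j g)//.
  by apply/seteqP; split => w; rewrite /gap_event/= in_itv/= andbT.
have act_or j : (j < m)%N -> act (re_resolvent z) j || act (im_resolvent z) j.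
  move=> jm; apply/negPn/negP; rewrite negb_or => /andP[/asboolPn nre /asboolPn nim].
  move/negP : nre; rewrite -ltNge => nre; move/negP : nim; rewrite -ltNge => nim.
  have : (P (X j @^-1` annulus a b) < (p + p)%:E)%E; last by rewrite ltNge pA.
  rewrite EFinD; apply: le_lt_trans (lteD nre nim).
  apply: le_trans (measureU2 P (mgap _ j mre) (mgap _ j mim)).
  apply: le_measure; rewrite ?inE//.
  - have := measurable_funPT (X j) measurableT _ (measurable_annulus a b).
    by rewrite setTI.
  - by apply: measurableU; exact: mgap.
  move=> w /= Xw; have := gap z j _ jm zK Xw.
  rewrite /gap_event/= => h; apply: contrapT => /not_orP[/negP h1 /negP h2].
  by move: h1 h2; rewrite -!ltNge; lra.
have dich : exists2 y, y = re_resolvent z \/ y = im_resolvent z &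
    (m0 <= \sum_(j < n) act y j)%N.
  have sum_mono (y : nat -> R[i] -> R) :
      (\sum_(j < m) act y j <= \sum_(j < n) act y j)%N.
    rewrite -!(big_mkord xpredT (fun j => act y j : nat)).
    by rewrite [X in (_ <= X)%N](big_cat_nat (n := m))//= leq_addr.
  have tot : (m <= \sum_(j < m) act (re_resolvent z) j +
      \sum_(j < m) act (im_resolvent z) j)%N.
    rewrite -big_split/= -[X in (X <= _)%N]card_ord -sum1_card.
    apply: leq_sum => j _; have := act_or j (ltn_ord j).
    by case: (act _ j); case: (act _ j).
  have [hre|hre] := leqP m0 (\sum_(j < m) act (re_resolvent z) j).
    by exists (re_resolvent z); [left|exact: leq_trans hre (sum_mono _)].
  exists (im_resolvent z); [by right|apply: leq_trans (sum_mono _)].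
  by move: tot hre; rewrite /m; lia.
have [y yz my0] := dich.
have my j : measurable_fun setT (y j) by case: yz => ->.
exists (partial_sum X y n @^-1` interval_union g [:: - (g / 2)]); split.
- have := measurable_partial_sum X my n.
  move=> /(_ measurableT _ (measurable_interval_union g [:: - (g / 2)])).
  by rewrite setTI.
- by apply: anti my (ltW g0) _ my0 => j /asboolP.
move=> w nw; rewrite log_deriv_perturbed.
apply: (@le_trans _ _ `|partial_sum X y n w|).
  rewrite leNgt; apply/negP; rewrite ltr_norml => /andP[h1 h2]; apply: nw.
  by rewrite /interval_union/= orbF; apply/andP; split; lra.
by case: yz => ->; [exact: (Re_le_normc (_ +i* _))|exact: (Im_le_normc (_ +i* _))].
Qed.

End perturbed_points.

(** * Empirical averages of the perturbed points *)

Section finite_unions.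
Context d (Omega : measurableType d) (R : realType) (P : probability Omega R).
Local Open Scope ereal_scope.

Lemma measurable_bigsetU (I : Type) (s : seq I) (Q : pred I) (F : I -> set Omega) :
  (forall i, measurable (F i)) -> measurable (\big[setU/set0]_(i <- s | Q i) F i).
Proof.
move=> mF; elim/big_ind: _ => // A B; exact: measurableU.
Qed.

Lemma probability_bigsetU_le (I : Type) (s : seq I) (Q : pred I)
    (F : I -> set Omega) : (forall i, measurable (F i)) ->
  P (\big[setU/set0]_(i <- s | Q i) F i) <= \sum_(i <- s | Q i) P (F i).
Proof.
move=> mF; elim: s => [|i s IH]; first by rewrite !big_nil measure0.
rewrite !big_cons; case: ifP => // _.
apply: le_trans (measureU2 P (mF i) (measurable_bigsetU s Q mF)) _.
by rewrite leeD2l.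
Qed.

End finite_unions.

Lemma prode_const (R : realType) (I : Type) (s : seq I) (c : R) :
  (\prod_(i <- s) c%:E = (c ^+ size s)%:E)%E.
Proof.
elim: s => [|i s IH]; first by rewrite big_nil.
by rewrite big_cons IH -EFinM -exprS.
Qed.

Section tail_counts.
Context d (Omega : measurableType d) (R : realType) (P : probability Omega R).
Variable X : nat -> {RV P >-> R[i]}.
Hypothesis indepX : mutually_independent P (fun n => X n : Omega -> R[i]).
Hypothesis identX : forall n, eq_distribution P (X n) (X 0%N).

Definition visit_count (A : set R[i]) (n : nat) (w : Omega) : nat :=
  #|[set k : 'I_n | `[< A (X k w) >]]%SET|.

(* Union bound over the [2 ^ n] possible sets of visit times. *)
Lemma visit_count_tail (A : set R[i]) (a n : nat) : measurable A ->
  (P (X 0%N @^-1` A) <= ((4 ^- a : R))%:E)%E ->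
  exists F : set Omega, [/\ measurable F, (P F <= ((2 ^- n : R))%:E)%E &
    forall w, ~ F w -> (a * visit_count A n w < n)%N].
Proof.
move=> mA PA.
pose J (S : {set 'I_n}) : {fset nat} := seq_fset tt [seq val k | k <- enum S].
pose cap S : set Omega := \bigcap_(j in [set` J S]) X j @^-1` A.
have mXA j : measurable (X j @^-1` A).
  by have := measurable_funPT (X j) measurableT _ mA; rewrite setTI.
have mcap S : measurable (cap S).
  by apply: fin_bigcap_measurable => [|j _]; [exact: finite_fset|exact: mXA].
have cJ S : size (J S) = #|S|.
  rewrite size_seq_fset undup_id ?size_map -?cardE//.
  by rewrite map_inj_uniq ?enum_uniq//; exact: val_inj.
have pf : P (X 0%N @^-1` A) \is a fin_num by exact: fin_num_measure.
set p := fine (P (X 0%N @^-1` A)).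
have p0 : 0 <= p by rewrite fine_ge0.
have p4 : p <= 4 ^- a by rewrite -lee_fin fineK.
have Pcap S : P (cap S) = (p ^+ #|S|)%:E.
  rewrite /cap (indepX (J S) (fun=> mA)) -cJ -prode_const.
  by apply: eq_bigr => j _; rewrite (identX j mA) fineK.
exists (\big[setU/set0]_(S : {set 'I_n} | (n <= a * #|S|)%N) cap S); split.
- exact: measurable_bigsetU.
- apply: le_trans (probability_bigsetU_le _ _ _ mcap) _.
  (* A set with [n <= a * #|S|] contributes [p ^ #|S| <= 4 ^- n], and there are at most [2 ^ n]
     sets. *)
  apply: (@le_trans _ _ (\sum_(S : {set 'I_n} | (n <= a * #|S|)%N) ((4 ^- n : R))%:E)%E).
    apply: lee_sum => S nS; rewrite Pcap lee_fin.
    apply: (@le_trans _ _ ((4 ^- a) ^+ #|S|)).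
      by rewrite lerXn2r ?nnegrE// invr_ge0 exprn_ge0.
    rewrite exprVn -exprM lef_pV2 ?posrE ?exprn_gt0//.
    by rewrite ler_weXn2l// ler1n.
  rewrite sumEFin lee_fin sumr_const.
  apply: (@le_trans _ _ ((4 ^- n : R) *+ (2 ^ n))).
    apply: ler_wpMn2l; first by rewrite invr_ge0 exprn_ge0.
    have <- : #|{set 'I_n}| = (2 ^ n)%N by rewrite -cardsT -powersetT card_powerset cardsT card_ord.
    exact: max_card.
  rewrite -[leLHS]mulr_natl natrX -[4%:R in leLHS](_ : 2 ^+ 2 = _); last by rewrite -natrX.
  by rewrite -exprM mulnC exprM expr2 invfM mulrA divff ?mul1r// expf_neq0.
move=> w nF; rewrite ltnNge; apply/negP => h; apply: nF.
pose S := [set k : 'I_n | `[< A (X k w) >]]%SET.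
rewrite (bigD1 S)//=; left => j /=; rewrite seq_fsetE => /mapP[k].
by rewrite mem_enum inE => /asboolP Ak ->.
Qed.

Lemma probability_tail_le (e : R) : 0 < e ->
  exists M : R, 0 <= M /\ (P (X 0%N @^-1` [set z | (M < normc z)%R]) <= e%:E)%E.
Proof.
move=> e0.
pose A (k : nat) := X 0%N @^-1` [set z : R[i] | normc z <= k%:R].
have mN (M : R) : measurable [set z : R[i] | normc z <= M].
  have := measurable_normc_sub (0 : R[i]) measurableT (measurable_itv `]-oo, M]).
  rewrite setTI (_ : _ @^-1` _ = [set z | normc z <= M])//.
  by apply/seteqP; split => z; rewrite /= in_itv/= subr0.
have mA k : measurable (A k).
  by have := measurable_funPT (X 0%N) measurableT _ (mN k%:R); rewrite setTI.
have ndA : nondecreasing_seq A.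
  move=> k l kl; apply/subsetPset => w /=; rewrite /A/= => /le_trans; apply.
  by rewrite ler_nat.
have UA : \bigcup_k A k = setT.
  apply/seteqP; split => // w _; exists (Num.truncn (normc (X 0%N w))).+1 => //=.
  by rewrite /A/= ltW// Num.Theory.truncnS_gt.
have : (fun k => P (A k)) @ \oo --> 1%E.
  have <- : P (\bigcup_k A k) = 1%E by rewrite UA; exact: probability_setT.
  exact: nondecreasing_cvg_mu mA (bigcup_measurable (fun k _ => mA k)) ndA.
move=> /fine_cvgP[_ /cvgrPdist_le /(_ _ e0)[k _ /(_ k (leqnn k)) kh]].
exists k%:R; split=> //.
have -> : X 0%N @^-1` [set z | (k%:R < normc z)%R] = ~` A k.
  apply/seteqP; split => w; rewrite /A/=.
    by rewrite ltNge => /negP.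
  by move=> /negP; rewrite -ltNge.
have Ak : P (A k) \is a fin_num by exact: fin_num_measure.
rewrite probability_setC// -(fineK Ak) -EFinB lee_fin.
exact: le_trans (ler_norm _) kh.
Qed.

End tail_counts.

Section empirical_averages.
Context d (Omega : measurableType d) (R : realType) (P : probability Omega R).
Variables (u : nat -> R[i]) (X : nat -> {RV P >-> R[i]}) (sigma : nat -> R).
Hypothesis indepX : mutually_independent P (fun n => X n : Omega -> R[i]).
Hypothesis identX : forall n, eq_distribution P (X n) (X 0%N).
Hypothesis sigma_gt0 : forall n, 0 < sigma n.
Hypothesis sigma_to0 : sigma n @[n --> \oo] --> 0.

Let far (M : R) : set R[i] := [set z | M < normc z].

(** A deterministic estimate: early indices and far values of [X k] cost [2 A] each, all other
    points move by at most [dl]. The integer [a] comes before [M] because [M] will be chosen so that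
    the tail beyond it is at most [4 ^- a]. *)
Lemma perturbed_sum_dist (f : R[i] -> R) (e : R) :
  unif_cont_plane f -> bounded_support f -> 0 < e ->
  exists a : nat, forall M, 0 <= M -> exists n0 : nat, forall n w, (n0 <= n)%N ->
  (a * visit_count X (far M) n w < n)%N ->
  `|\sum_(v <- perturbed_points u X sigma n w) f v - \sum_(k < n) f (u k)| <=
  e * n%:R.
Proof.
move=> uf sf e0; have [A A0 fA] := unif_cont_bounded uf sf.
have e3 : 0 < e / 3 by rewrite divr_gt0.
have [dl dl0 fd] := uf _ e3.
(* At most [n / a] far values cost at most [2 A n / a <= e n / 3]; [n0] below plays the same role
   for the [k0] early indices. *)
pose a := (Num.truncn (6 * A / e)).+1.
have ae : 6 * A / e < a%:R by exact: Num.Theory.truncnS_gt.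
exists a => M M0.
have [k0 _ hk0] : \forall k \near \oo, sigma k * M <= dl.
  have h0 : 0 < dl / (M + 1) by rewrite divr_gt0// ltr_wpDl.
  move/cvgrPdist_le : sigma_to0 => /(_ _ h0); apply: filterS => k.
  rewrite sub0r normrN gtr0_norm// ler_pdivlMr ?ltr_wpDl// => /(le_trans _); apply.
  by rewrite ler_wpM2l ?(ltW (sigma_gt0 k))// lerDl.
pose n0 := (Num.truncn (6 * A * k0%:R / e)).+1.
have n0e : 6 * A * k0%:R / e < n0%:R by exact: Num.Theory.truncnS_gt.
exists n0 => n w nn0 cnt.
rewrite /perturbed_points big_mkseq.
rewrite -sumrB; apply: le_trans (ler_norm_sum _ _ _) _.
pose V : pred 'I_n := fun k => `[< far M (X k w) >].
apply: (@le_trans _ _ (\sum_(k < n) (e / 3 + 2 * A * ((k < k0)%N%:R + (V k)%:R)))).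
  apply: ler_sum => k _.
  have triv : `|f (u k + (sigma k)%:C * X k w) - f (u k)| <= 2 * A.
    by rewrite mulr_natl mulr2n (le_trans (ler_normB _ _))// lerD.
  have A2 : 0 <= 2 * A by rewrite mulr_ge0// ltW.
  have [kk0|kk0] := ltnP k k0.
    apply: (le_trans triv); apply: ler_wpDl; first exact: ltW.
    by rewrite ler_peMr// lerDl.
  case Vk : (V k).
    apply: (le_trans triv); apply: ler_wpDl; first exact: ltW.
    by rewrite add0r mulr1.
  rewrite addr0 mulr0 addr0; apply: fd.
  rewrite addrC addKr normcM normc_real (gtr0_norm (sigma_gt0 k)).
  apply: le_trans (hk0 k kk0); rewrite ler_wpM2l ?(ltW (sigma_gt0 k))//.
  by rewrite leNgt; apply/negP => h; move/negP : Vk; apply; exact/asboolP.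
rewrite big_split/= sumr_const card_ord -mulr_sumr big_split/=.
rewrite -[_ *+ n]mulr_natr.
have c1 : \sum_(k < n) (k < k0)%N%:R <= k0%:R :> R.
  rewrite -natr_sum ler_nat -big_mkcond/= sum1_card.
  by apply: (@card_window _ k0) => i j ik0 _; exact: leq_trans ik0 (leq_addl _ _).
have c2 : \sum_(k < n) (V k)%:R = (visit_count X (far M) n w)%:R :> R.
  rewrite -natr_sum -big_mkcond/= sum1_card /visit_count; congr (_%:R).
  by apply: eq_card => k; rewrite !inE.
rewrite c2.
have c3 : a%:R * (visit_count X (far M) n w)%:R <= n%:R :> R.
  by rewrite -natrM ler_nat ltnW.
move: (visit_count _ _ _ _)%:R c3 (ler0n R (visit_count X (far M) n w)) => c c3 c0.
move: c1; set q := \sum_(k < n) _ => c1.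
have nn : n0%:R <= n%:R :> R by rewrite ler_nat.
have h1 : 6 * A * k0%:R <= e * n%:R.
  by rewrite -ler_pdivrMl// mulrC (le_trans (ltW n0e)).
have h2 : 6 * A * c <= e * n%:R.
  have : 6 * A * c <= e * a%:R * c.
    by rewrite ler_wpM2r// -ler_pdivrMl// mulrC ltW.
  by move/le_trans; apply; rewrite -mulrA ler_wpM2l// ltW.
have h3 : 6 * A * q <= 6 * A * k0%:R by rewrite ler_wpM2l// mulr_ge0// ltW.
have -> : 2 * A * (q + c) = (6 * A * q + 6 * A * c) / 3 by field.
lra.
Qed.

Lemma expVn_le (e : R) : 0 < e ->
  exists n0 : nat, forall n : nat, (n0 <= n)%N -> 2 ^- n <= e.
Proof.
move=> e0; have : (fun k => (2^-1 : R) ^+ k) @ \oo --> (0 : R).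
  by apply: cvg_expr; rewrite ger0_norm//; lra.
move/cvgrPdist_le => /(_ _ e0) [n0 _ h]; exists n0 => n nn0.
by have := h n nn0; rewrite sub0r normrN ger0_norm ?exprn_ge0// exprVn.
Qed.

Lemma far_visits (a : nat) : exists2 M : R, 0 <= M &
  exists F : nat -> set Omega, forall n, [/\ measurable (F n),
    (P (F n) <= ((2 ^- n : R))%:E)%E &
    forall w, ~ F n w -> (a * visit_count X (far M) n w < n)%N].
Proof.
have a4 : (0 : R) < 4 ^- a by rewrite invr_gt0 exprn_gt0.
have [M [M0 PM]] := probability_tail_le X a4.
exists M => //.
suff /choice[F hF] (n : nat) : exists F : set Omega, [/\ measurable F,
    (P F <= ((2 ^- n : R))%:E)%E &
    forall w, ~ F w -> (a * visit_count X (far M) n w < n)%N] by exists F.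
apply: visit_count_tail => //.
have := measurable_normc_sub (0 : R[i]) measurableT (measurable_itv `]M, +oo[).
rewrite setTI (_ : _ @^-1` _ = far M)//.
by apply/seteqP; split => z; rewrite /far/= in_itv/= subr0 andbT.
Qed.

Lemma perturbed_sum_in_probability (f : R[i] -> R) (e eta : R) :
  unif_cont_plane f -> bounded_support f -> 0 < e -> 0 < eta ->
  exists n0 : nat, forall n, (n0 <= n)%N ->
  exists A : set Omega, [/\ measurable A, (P A <= eta%:E)%E &
    forall w, ~ A w ->
    `|\sum_(v <- perturbed_points u X sigma n w) f v - \sum_(k < n) f (u k)| <=
    e * n%:R].
Proof.
move=> uf sf e0 eta0; have [a ha] := perturbed_sum_dist uf sf e0.
have [M M0 [F FP]] := far_visits a.
have [n0 hn0] := ha M M0; have [n1 hn1] := expVn_le eta0.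
exists (maxn n0 n1) => n; rewrite geq_max => /andP[nn0 nn1].
have [mF PF Fw] := FP n; exists (F n); split=> //.
  by rewrite (le_trans PF)// lee_fin hn1.
by move=> w /Fw; exact: hn0.
Qed.

(** The null set must serve all test functions at once. As [f] and [e] enter only through the
    integer [a], a countable union of upper limits suffices. *)
Lemma perturbed_sum_almost_surely :
  {ae P, forall w, forall f : R[i] -> R, unif_cont_plane f -> bounded_support f ->
    forall e, 0 < e -> exists n0 : nat, forall n, (n0 <= n)%N ->
    `|\sum_(v <- perturbed_points u X sigma n w) f v - \sum_(k < n) f (u k)| <=
    e * n%:R}.
Proof.
have /choice[M hM] (a : nat) : exists M : R, 0 <= M /\
    exists F : nat -> set Omega, forall n, [/\ measurable (F n),
    (P (F n) <= ((2 ^- n : R))%:E)%E &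
    forall w, ~ F n w -> (a * visit_count X (far M) n w < n)%N].
  by have [M M0 h] := far_visits a; exists M.
have /choice[F hF] (a : nat) := (hM a).2.
have nF : P.-negligible (\bigcup_a lim_sup_set (F a)).
  apply: negligible_bigcup => a; exists (lim_sup_set (F a)); split=> //.
    apply: bigcapT_measurable => k; apply: bigcup_measurable => n _.
    by case: (hF a n).
  apply: lim_sup_set_cvg0; first by move=> n; case: (hF a n).
  apply: (@le_lt_trans _ _ (\sum_(n <oo) ((2 ^- n : R))%:E)%E).
    by apply: lee_nneseries => n _ //; case: (hF a n).
  have pow n : 2 ^- n = 2 / (2 ^ n.+1)%:R :> R.
    by rewrite natrX exprS invfM mulrA divff ?mul1r.
  under eq_eseriesr do rewrite pow.
  by apply: le_lt_trans (epsilon_trick0 _ _) _ => //; rewrite ltry.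
apply: negligibleS nF => w /= nw; apply: contrapT => nU; apply: nw => f uf sf e e0.
have [a ha] := perturbed_sum_dist uf sf e0.
have [n0 hn0] := ha _ (hM a).1.
have [n1 hn1] : exists n1 : nat, forall n, (n1 <= n)%N -> ~ F a n w.
  apply: contrapT => h; apply: nU; exists a => // n _ /=.
  apply: contrapT => nn; apply: h; exists n => m nm Fm; apply: nn.
  by exists m.
exists (maxn n0 n1) => n; rewrite geq_max => /andP[nn0 nn1].
by apply: hn0 => //; have [_ _] := hF a n; apply; exact: hn1.
Qed.

End empirical_averages.

(** * Zeros of the derivative *)

Section in_probability.
Context d (Omega : measurableType d) (R : realType) (P : probability Omega R).

(** The expected number of events is at most [eta / 2 * #|I|]; Markov's inequality is applied at the
    level [#|I| / 2]. *)
Lemma count_events_markov (I : finType) (E : I -> set Omega) (eta : R) :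
  0 < eta -> (forall i, measurable (E i)) ->
  (forall i, (P (E i) <= (eta / 2)%:E)%E) ->
  exists B : set Omega, [/\ measurable B, (P B <= eta%:E)%E &
    forall w, ~ B w -> (2 * #|[set i | `[< E i w >]]%SET| <= #|I|)%N].
Proof.
move=> eta0 mE PE; have [I0|I0] := posnP #|I|.
  exists set0; split=> [//||w _]; first by rewrite measure0 lee_fin ltW.
  rewrite (@leq_trans (2 * #|I|))//; last by rewrite I0.
  by rewrite leq_mul2l max_card orbT.
pose Z w : R := \sum_i \1_(E i) w.
have ZE w : Z w = #|[set i | `[< E i w >]]%SET|%:R.
  rewrite /Z -sum1_card natr_sum [RHS]big_mkcond/=; apply: eq_bigr => i _.
  by rewrite indicE inE; case: asboolP => h; [rewrite mem_set|rewrite memNset].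
have mZ : measurable_fun setT Z.
  by apply: measurable_sum => i; exact: measurable_indic.
pose h : R := #|I|%:R / 2.
have h0 : 0 < h by rewrite divr_gt0// ltr0n.
pose B := [set w | h < Z w].
have mB : measurable B.
  have := mZ measurableT _ (measurable_itv `]h, +oo[); rewrite setTI.
  rewrite (_ : _ @^-1` _ = B)//.
  by apply/seteqP; split => w; rewrite /B/= in_itv/= andbT.
exists B; split=> //; last first.
  move=> w /negP; rewrite -leNgt ZE /h ler_pdivlMr//.
  by rewrite mulrC -natrM ler_nat.
have Z0 w : 0 <= Z w by apply: sumr_ge0 => i _; rewrite indicE.
have hB : (h%:E * P B <= \int[P]_w (Z w)%:E)%E.
  have mI : measurable_fun setT (fun w => (\1_B w : R)%:E).
    by apply/measurable_EFinP; exact: measurable_indic.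
  have -> : (h%:E * P B = \int[P]_w (h%:E * (\1_B w)%:E))%E.
    rewrite ge0_integralZl//; first by rewrite integral_indic// setIT.
    by rewrite lee_fin ltW.
  apply: ge0_le_integral => //.
  - by move=> w _; rewrite mule_ge0// lee_fin ?indicE// ltW.
  - by apply: emeasurable_funM => //; apply/measurable_EFinP; exact: measurable_indic.
  - exact/measurable_EFinP.
  move=> w _; rewrite -EFinM lee_fin indicE.
  by have [wB|_] := boolP (w \in B); rewrite ?mulr1 ?mulr0//; move: wB; rewrite inE => /ltW.
have ZI : (\int[P]_w (Z w)%:E <= (h * eta)%:E)%E.
  under eq_integral do rewrite -sumEFin.
  rewrite ge0_integral_sum//; last first.
    by move=> i; apply/measurable_EFinP; exact: measurable_indic.
  apply: (@le_trans _ _ (\sum_(i : I) (eta / 2)%:E)%E).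
    by apply: lee_sum => i _; rewrite integral_indic// setIT; exact: PE.
  rewrite sumEFin lee_fin sumr_const -[leLHS]mulr_natl /h -/(#|I|).
  by rewrite le_eqVlt; apply/orP; left; apply/eqP; ring.
have PBf : P B \is a fin_num by exact: fin_num_measure.
have := le_trans hB ZI; rewrite -(fineK PBf) -EFinM !lee_fin.
by rewrite ler_pM2l.
Qed.

(** Only the exceptional set is required to be measurable: the zeros of a polynomial are listed by a
    choice that says nothing about measurability in [w]. *)
Definition with_high_probability (E : nat -> Omega -> Prop) : Prop :=
  forall eta : R, 0 < eta -> exists n0 : nat, forall n, (n0 <= n)%N ->
  exists A : set Omega, [/\ measurable A, (P A <= eta%:E)%E &
    forall w, ~ A w -> E n w].

Lemma with_high_probability_and E1 E2 :
  with_high_probability E1 -> with_high_probability E2 ->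
  with_high_probability (fun n w => E1 n w /\ E2 n w).
Proof.
move=> h1 h2 eta eta0; have e2 : 0 < eta / 2 by rewrite divr_gt0.
have [n1 H1] := h1 _ e2; have [n2 H2] := h2 _ e2.
exists (maxn n1 n2) => n; rewrite geq_max => /andP[nn1 nn2].
have [A1 [mA1 PA1 EA1]] := H1 n nn1; have [A2 [mA2 PA2 EA2]] := H2 n nn2.
exists (A1 `|` A2); split; first exact: measurableU.
  apply: le_trans (measureU2 P mA1 mA2) _.
  by rewrite [eta]splitr EFinD leeD.
by move=> w /not_orP[/EA1 ? /EA2 ?].
Qed.

Lemma with_high_probability_mono E1 E2 :
  (exists n0 : nat, forall n w, (n0 <= n)%N -> E1 n w -> E2 n w) ->
  with_high_probability E1 -> with_high_probability E2.
Proof.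
move=> [n0 E12] h1 eta eta0; have [n1 H1] := h1 _ eta0.
exists (maxn n0 n1) => n; rewrite geq_max => /andP[nn0 nn1].
have [A [mA PA EA]] := H1 n nn1.
by exists A; split=> // w /EA; exact: E12.
Qed.

End in_probability.

Section critical_points.
Context d (Omega : measurableType d) (R : realType) (P : probability Omega R).
Variables (u : nat -> R[i]) (X : nat -> {RV P >-> R[i]}) (sigma : nat -> R).
Hypothesis indepX : mutually_independent P (fun n => X n : Omega -> R[i]).
Hypothesis identX : forall n, eq_distribution P (X n) (X 0%N).
Hypothesis nondegX : ~ {ae P, forall w, X 0%N w = 0}.
Hypothesis symX : forall n, eq_distribution P (X n) (fun w => - X n w).
Hypothesis sigma_gt0 : forall n, 0 < sigma n.
Hypothesis sigma_to0 : sigma n @[n --> \oo] --> 0.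

Local Notation S := (perturbed_points u X sigma).

Definition critical_points (n : nat) (w : Omega) : seq R[i] :=
  zeros (\prod_(v <- S n w) ('X - v%:P))^`().
Local Notation T := critical_points.

Lemma size_perturbed_points n w : size (S n w) = n.
Proof. by rewrite size_mkseq. Qed.

Lemma size_critical_points n w : (0 < n)%N -> n = (size (T n w)).+1.
Proof.
move=> n0; have [] := @zeros_deriv_prod_XsubC _ (S n w).
  by rewrite size_perturbed_points.
by rewrite size_perturbed_points.
Qed.

(** Each candidate has [N] roots, each failing with probability at most [eta / (2 N)]. Then a
    candidate is bad with probability at most [eta / 2], and outside an event of probability [eta]
    at most [8 n] of the [16 n] candidates are bad. *)
Lemma jensen_in_probability (c : R[i]) (r e : R) : 0 < r -> 0 < e ->
  with_high_probability P (fun n w =>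
    `|\sum_(x <- T n w) log_plus_disc c r x -
      \sum_(v <- S n w) log_plus_disc c r v| <= e * n%:R).
Proof.
move=> r0 e0 eta eta0.
(* Makes the error [130 n / N] at most [e n / 2]; the logarithmic terms share the rest. *)
pose N := (Num.truncn (260 / e)).+1.
have Ne : 260 / e < N%:R by exact: Num.Theory.truncnS_gt.
have N0 : (0 : R) < N%:R by rewrite ltr0n.
have eN0 : 0 < eta / 2 / N%:R by rewrite !divr_gt0.
have [dl [m [dl0 anti]]] := log_deriv_anticoncentration u indepX identX nondegX
  symX sigma_gt0 (normc c + r) eN0.
have e2 : 0 < e / 2 by rewrite divr_gt0.
have [n1 hn1] := log_affine_bound (`|ln dl| + 2 * `|ln r| + ln (64 * N%:R)) e2.
exists (maxn 1 (maxn m n1)) => n; rewrite !geq_max => /and3P[n0 nm nn1].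
have /choice[A hA] (z : R[i]) : exists A : set Omega,
    [/\ measurable A, (P A <= (eta / 2 / N%:R)%:E)%E & normc z <= normc c + r ->
    forall w, ~ A w -> dl <= normc (log_deriv (S n w) z)].
  have [zK|zK] := leP (normc z) (normc c + r).
    by have [A [mA PA h]] := anti n z nm zK; exists A; split.
  exists set0; split=> //; first by rewrite measure0 lee_fin ltW.
have /choice[rs hrs] (l : 'I_(16 * n)) : exists rs : seq R[i],
    [/\ size rs = N, forall z, z \in rs -> normc z = 1 &
     forall z, z ^+ N = circle_pt R (16 * n) l -> z \in rs].
  have [rs [h1 _ h3 h4]] := @unity_roots_seq R N _ (ltn0Sn _) (normc_circle_pt R (16 * n) l).
  exists rs; split=> // z zN; have := h4 z; rewrite zN subrr normc0 => /eqP.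
  rewrite prodf_seq_eq0 => /hasP[x xrs /=]; rewrite normc_eq0 subr_eq0.
  by move=> /eqP <-.
pose E l := \big[setU/set0]_(z <- rs l) A (c + r%:C * z).
have mE l : measurable (E l).
  by apply: measurable_bigsetU => z; case: (hA (c + r%:C * z)).
have PE l : (P (E l) <= (eta / 2)%:E)%E.
  apply: le_trans (probability_bigsetU_le P (rs l) xpredT
    (F := fun z => A (c + r%:C * z)) _) _.
    by move=> z; case: (hA (c + r%:C * z)).
  apply: (@le_trans _ _ (\sum_(z <- rs l) (eta / 2 / N%:R)%:E)%E).
    by apply: lee_sum => z _; case: (hA (c + r%:C * z)).
  have [srs _ _] := hrs l.
  rewrite sumEFin lee_fin big_const_seq count_predT srs iter_addr_0.
  by rewrite -[_ *+ N]mulr_natr divfK// gt_eqF.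
have [B [mB PB cB]] := count_events_markov eta0 mE PE.
exists B; split=> // w /cB; rewrite card_ord => cBad.
have sS := size_perturbed_points n w.
have S0 : (0 < size (S n w))%N by rewrite sS.
have [size_st deriv_st] := zeros_deriv_prod_XsubC S0.
rewrite -/(T n w) in size_st deriv_st.
pose Bad : {set 'I_(16 * n)} := [set l | `[< E l w >]]%SET.
have cBad8 : (#|Bad| <= 8 * n)%N.
  by rewrite -(@leq_pmul2l 2)// mulnA; exact: cBad.
have goodL (l : 'I_(16 * n)) z : l \notin Bad -> z ^+ N = circle_pt R (16 * n) l ->
    expR (- `|ln dl|) <= normc (log_deriv (S n w) (c + r%:C * z)).
  rewrite inE => /asboolPn lE zN.
  have [_ rs1 rsz] := hrs l; have zrs := rsz z zN.
  apply: (@le_trans _ _ dl).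
    by rewrite -[leRHS]lnK ?posrE// ler_expR lerNl -normrN ler_norm.
  have [_ _ h] := hA (c + r%:C * z); apply: h.
    rewrite (le_trans (le_normcD _ _))// normcM normc_real (gtr0_norm r0).
    by rewrite (rs1 _ zrs) mulr1.
  move=> Az; apply: lE; rewrite /E (big_rem z)//=; left; exact: Az.
have := @jensen_compare R (S n w) (T n w) deriv_st size_st c r `|ln dl| N.
rewrite sS => /(_ Bad r0 (normr_ge0 _) (ltn0Sn _) cBad8 goodL).
move/le_trans; apply.
have h1 : 130 * n%:R / N%:R <= e / 2 * n%:R.
  rewrite mulrAC ler_wpM2r// ler_pdivrMr//.
  by move: Ne; rewrite ltr_pdivrMr// => h; lra.
have := hn1 n nn1; lra.
Qed.

Lemma bump_in_probability (c : R[i]) (r e : R) : 0 < r -> 0 < e ->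
  with_high_probability P (fun n w =>
    `|\sum_(x <- T n w) bump c r x - \sum_(v <- S n w) bump c r v| <= e * n%:R).
Proof.
move=> r0 e0; have l2 : 0 < ln (2 : R) by rewrite ln_gt0// ltr1n.
(* The two Jensen errors contribute [2 e' n / ln 2 = e n / 2], and the extra 1 is at most [e n / 2]
   once [n >= 2 / e]. *)
pose e' := e * ln 2 / 4; have e'0 : 0 < e' by rewrite divr_gt0// mulr_gt0.
have r20 : 0 < 2 * r by rewrite mulr_gt0.
apply: with_high_probability_mono
  (with_high_probability_and (jensen_in_probability c r0 e'0)
    (jensen_in_probability c r20 e'0)).
exists (Num.truncn (2 / e)).+1 => n w nn0 [h1 h2].
have n0 : (0 < n)%N by exact: leq_trans nn0.
have size_st : size (S n w) = (size (T n w)).+1.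
  by rewrite size_perturbed_points -size_critical_points.
apply: le_trans (sum_bump_dist size_st h1 h2) _.
have : 2 / e <= n%:R.
  by rewrite (le_trans (ltW (Num.Theory.truncnS_gt _)))// ler_nat.
rewrite ler_pdivrMr// => h3.
rewrite (_ : 2 * _ / _ = e * n%:R / 2); last by rewrite /e'; field; rewrite gt_eqF.
by rewrite [e * _]mulrC; lra.
Qed.

Lemma bump_sum_in_probability (s : seq (R * R[i] * R)) (e : R) :
  pos_radii s -> 0 < e ->
  with_high_probability P (fun n w =>
    `|\sum_(x <- T n w) bump_sum s x - \sum_(v <- S n w) bump_sum s v| <= e * n%:R).
Proof.
elim: s e => [|p s IH] e sr e0.
  move=> eta eta0; exists 0%N => n _; exists set0; split=> //.
    by rewrite measure0 lee_fin ltW.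
  move=> w _; rewrite /bump_sum; under eq_bigr do rewrite big_nil.
  under [X in _ - X]eq_bigr do rewrite big_nil.
  by rewrite !big1// subrr normr0 mulr_ge0// ltW.
have e2 : 0 < e / 2 by rewrite divr_gt0.
have a0 : 0 < `|p.1.1| + 1 by rewrite ltr_wpDl.
have e3 : 0 < e / 2 / (`|p.1.1| + 1) by rewrite divr_gt0.
have := with_high_probability_and
  (bump_in_probability p.1.2 (sr p (mem_head _ _)) e3)
  (IH (e / 2) (fun q qs => sr q (mem_behead (s := p :: s) qs)) e2).
apply: with_high_probability_mono; exists 0%N => n w _ [h1 h2].
have E (t : seq R[i]) : \sum_(x <- t) bump_sum (p :: s) x =
    p.1.1 * \sum_(x <- t) bump p.1.2 p.2 x + \sum_(x <- t) bump_sum s x.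
  rewrite mulr_sumr -big_split/=; apply: eq_bigr => x _.
  by rewrite /bump_sum big_cons.
rewrite !E opprD addrACA -mulrBr (le_trans (ler_normD _ _))//.
rewrite [e in leRHS]splitr mulrDl lerD// normrM.
apply: (@le_trans _ _ ((`|p.1.1| + 1) * (e / 2 / (`|p.1.1| + 1) * n%:R))).
  by apply: ler_pM => //; rewrite lerDl.
by rewrite mulrA mulrCA divff ?gt_eqF// mulr1.
Qed.

Lemma test_function_in_probability (f : R[i] -> R) (e : R) :
  unif_cont_plane f -> bounded_support f -> 0 < e ->
  with_high_probability P (fun n w =>
    `|\sum_(x <- T n w) f x - \sum_(v <- S n w) f v| <= e * n%:R).
Proof.
move=> uf sf e0; have e4 : 0 < e / 4 by rewrite divr_gt0.
have e2 : 0 < e / 2 by rewrite divr_gt0.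
have [s sr fs] := bump_sum_dense uf sf e4.
apply: with_high_probability_mono (bump_sum_in_probability sr e2).
exists 1%N => n w n0 h.
have D (t : seq R[i]) : (size t <= n)%N ->
    `|\sum_(x <- t) f x - \sum_(x <- t) bump_sum s x| <= e / 4 * n%:R.
  move=> tn; rewrite -sumrB (le_trans (ler_norm_sum _ _ _))//.
  apply: (@le_trans _ _ (\sum_(x <- t) e / 4)); first exact: ler_sum.
  rewrite big_const_seq count_predT iter_addr_0 -[_ *+ _]mulr_natr.
  by rewrite ler_wpM2l ?(ltW e4)// ler_nat.
have Tn : (size (T n w) <= n)%N by rewrite [leqRHS](size_critical_points w n0).
have Sn : (size (S n w) <= n)%N by rewrite size_perturbed_points.
move: (D _ Tn) (D _ Sn) h.
move: (\sum_(x <- T n w) f x) (\sum_(x <- T n w) bump_sum s x) => a b.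
move: (\sum_(x <- S n w) f x) (\sum_(x <- S n w) bump_sum s x) => a' b' h1 h2 h.
rewrite (_ : a - a' = (a - b) + (b - b') - (a' - b')); last by ring.
apply: le_trans (ler_normB _ _) _; apply: le_trans (lerD (ler_normD _ _) (lexx _)) _.
lra.
Qed.

End critical_points.

(** * Convergence in probability for the weak topology *)

Section inner_probability_limit.
Context d (Omega : measurableType d) (R : realType) (P : probability Omega R).

Lemma inner_probability_le1 (E : set Omega) : (inner_probability P E <= 1)%E.
Proof.
by apply: ge_ereal_sup => _ [A [mA _] <-]; exact: probability_le1.
Qed.

Lemma inner_probability_cvg1 (E : nat -> Omega -> Prop) :
  with_high_probability P E ->
  inner_probability P [set w | E n w] @[n --> \oo] --> 1%E.
Proof.
move=> hE.
have low (eta : R) : 0 < eta -> exists n0 : nat, forall n, (n0 <= n)%N ->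
    ((1 - eta)%:E <= inner_probability P [set w | E n w])%E.
  move=> eta0; have [n0 H] := hE _ eta0; exists n0 => n nn0.
  have [A [mA PA EA]] := H n nn0.
  apply: (@le_trans _ _ (P (~` A))).
    have Af : P A \is a fin_num by exact: fin_num_measure.
    rewrite probability_setC// -(fineK Af) -EFinB lee_fin lerD2l lerN2.
    by rewrite -lee_fin fineK.
  apply: ereal_sup_ubound; exists (~` A) => //; split; first exact: measurableC.
  by move=> w /= /EA.
have fin n : inner_probability P [set w | E n w] \is a fin_num.
  rewrite fin_numElt; apply/andP; split; last first.
    by apply: le_lt_trans (inner_probability_le1 _) _; rewrite ltry.
  apply: (@lt_le_trans _ _ 0%E); first exact: ltNyr.
  apply: ereal_sup_ubound; exists set0; last exact: measure0.
  by split=> //; exact: sub0set.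
apply/fine_cvgP; split; first exact: nearW.
apply/cvgrPdist_le => e e0; have [n0 H] := low _ e0.
exists n0 => // n nn0; have := H n nn0; have := inner_probability_le1 [set w | E n w].
rewrite /= -(fineK (fin n)) !lee_fin => h1 h2.
by rewrite ger0_norm ?subr_ge0// lerBlDr addrC -lerBlDr.
Qed.

(* The sets hit by [nu n] with high probability form a filter, which is finer
   than the neighbourhoods of [mu] in an initial topology as soon as it is so
   along each test function. *)
Lemma weakly_cvg_in_probability_tests (nu : nat -> Omega -> probability R[i] R)
    (mu : probability R[i] R) :
  (forall (f : R[i] -> R) e, Cc_infty f -> 0 < e -> with_high_probability P
     (fun n w => `|\int[mu]_z f z - \int[nu n w]_z f z| <= e)) ->
  weakly_cvg_in_probability P nu mu.
Proof.
move=> htest N Nmu; apply: inner_probability_cvg1.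
pose G : set_system (weak_probability R) :=
  [set A | with_high_probability P (fun n w => A (nu n w))].
have FG : Filter G.
  split.
  - move=> eta eta0; exists 0%N => n _; exists set0; split=> //.
    by rewrite measure0 lee_fin ltW.
  - by move=> A B GA GB; exact: with_high_probability_and.
  - move=> A B AB; apply: with_high_probability_mono.
    by exists 0%N => n w _; exact: AB.
suff cvG : G --> (mu : weak_probability R) by exact: cvG.
move=> A [_ [[B Bop <-] Bmu] BA].
have cv : (@test_integrals R) @ G --> test_integrals mu.
  apply/cvg_sup => f C [_ [[D Dop <-] Df] DC].
  apply: filterS DC _.
  have /nbhs_ballP[/= e e0 De] : nbhs (\int[mu]_z (sval f z)) D.
    exact: open_nbhs_nbhs.
  have e2 : 0 < e / 2 by rewrite divr_gt0.
  apply: with_high_probability_mono (htest _ _ (svalP f) e2).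
  exists 0%N => n w _ h; apply: De; rewrite /ball/=.
  by apply: le_lt_trans h _; rewrite ltr_pdivrMr// mulr_natr mulr2n ltrDl.
by apply: filterS BA _; apply: cv; exact: open_nbhs_nbhs.
Qed.

End inner_probability_limit.

Lemma nonincreasing_cvg0_gt0 (R : realType) (s : nat -> R) :
  nonincreasing_seq s -> s n @[n --> \oo] --> 0 -> (forall n, s n != 0) ->
  forall n, 0 < s n.
Proof.
move=> ds s0 sn0 n; rewrite lt_neqAle eq_sym sn0/=.
have := nonincreasing_cvgn_ge ds (cvgP _ s0) n.
by rewrite (cvg_lim _ s0).
Qed.

Theorem corollary1p10 (R : realType)
  (d : measure_display) (Omega : measurableType d) (P : probability Omega R)
  (mu : probability R[i] R) (u : nat -> R[i])
  (hu_distributed : distributed_as mu u)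
  (hu_bounded : log_cesaro_bounded u)
  (X : nat -> {RV P >-> R[i]})
  (hX_independent : mutually_independent P (fun n => X n : Omega -> R[i]))
  (hX_identical : forall n, eq_distribution P (X n) (X 0%N))
  (hX_nondegenerate : ~ {ae P, forall w, X 0%N w = 0})
  (hX_symmetric : forall n, eq_distribution P (X n) (fun w => - X n w))
  (hX_integrable : forall n, ('E_P[fun w => normc (X n w)] < +oo)%E)
  (sigma : nat -> R)
  (hsigma_nonincreasing : nonincreasing_seq sigma)
  (hsigma_lim : sigma n @[n --> \oo] --> 0)
  (hsigma_neq0 : forall n, sigma n != 0) :
  let v (n : nat) (w : Omega) : R[i] := u n + (sigma n)%:C * X n w in
  let poly_ (n : nat) (w : Omega) : {poly R[i]} :=
    \prod_(k < n) ('X - (v k w)%:P) in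
  weakly_cvg_almost_surely P (fun n w => zero_measure (poly_ n w)) mu /\
  weakly_cvg_in_probability P (fun n w => zero_measure (poly_ n w)^`()) mu.
Proof.
move=> v poly_.
have sigma0 := nonincreasing_cvg0_gt0 hsigma_nonincreasing hsigma_lim hsigma_neq0.
have polyE n w : poly_ n w = \prod_(x <- perturbed_points u X sigma n w) ('X - x%:P).
  by rewrite /perturbed_points big_mkseq.
have int_u (f : R[i] -> R) e : Cc_infty f -> 0 < e -> exists n0 : nat,
    forall n, (n0 <= n)%N -> `|\int[mu]_z f z - n%:R^-1 * \sum_(k < n) f (u k)| <= e.
  move=> Cf e0; have /cvgrPdist_le/(_ _ e0)[n0 _ H] := hu_distributed f Cf.
  exists n0.+1 => n nn0; have := H n (ltnW nn0).
  rewrite Rintegral_uniform_on; last exact: measurable_Cc_infty.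
    by rewrite size_mkseq big_mkseq.
  by rewrite -size_eq0 size_mkseq -lt0n (leq_trans _ nn0).
have int_v (f : R[i] -> R) n w : Cc_infty f -> (0 < n)%N ->
    \int[zero_measure (poly_ n w)]_z f z =
    n%:R^-1 * \sum_(x <- perturbed_points u X sigma n w) f x.
  move=> Cf n0; have pz := zeros_prod_XsubC (perturbed_points u X sigma n w).
  rewrite -polyE in pz.
  rewrite /zero_measure Rintegral_uniform_on; last exact: measurable_Cc_infty.
    by rewrite (perm_size pz) size_perturbed_points (perm_big _ pz).
  by rewrite -size_eq0 (perm_size pz) size_perturbed_points -lt0n.
split.
  have := perturbed_sum_almost_surely u hX_independent hX_identical sigma0 hsigma_lim.
  apply: filterS => w hw f Cf.
  have uf := Cc_infty_unif_cont Cf; have sf := Cc_infty_bounded_support Cf.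
  apply/cvgrPdist_le => e e0; have e2 : 0 < e / 2 by rewrite divr_gt0.
  have [n1 h1] := hw f uf sf _ e2; have [n2 h2] := int_u f _ Cf e2.
  exists (maxn 1 (maxn n1 n2)) => // n /=; rewrite !geq_max => /and3P[n0 nn1 nn2].
  have nR : (0 : R) < n%:R by rewrite ltr0n.
  rewrite int_v//; have := h1 n nn1; have := h2 n nn2.
  move: (\int[mu]_z f z) => I; move: (\sum_(k < n) f (u k)) => U.
  move: (\sum_(x <- _) f x) => V hU hV.
  rewrite (_ : I - _ = (I - n%:R^-1 * U) - n%:R^-1 * (V - U)); last by ring.
  rewrite (le_trans (ler_normB _ _))// [e]splitr lerD// normrM.
  by rewrite gtr0_norm ?invr_gt0// ler_pdivrMl// mulrC.
apply: weakly_cvg_in_probability_tests => f e Cf e0.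
have uf := Cc_infty_unif_cont Cf; have sf := Cc_infty_bounded_support Cf.
have [A A0 fA] := unif_cont_bounded uf sf.
have e4 : 0 < e / 4 by rewrite divr_gt0.
have [n1 h1] := int_u f _ Cf e4.
have h2 := test_function_in_probability u hX_independent hX_identical
  hX_nondegenerate hX_symmetric sigma0 uf sf e4.
have h3 : with_high_probability P (fun n w =>
    `|\sum_(x <- perturbed_points u X sigma n w) f x - \sum_(k < n) f (u k)| <=
    e / 4 * n%:R).
  move=> eta eta0; exact: (perturbed_sum_in_probability u hX_independent
    hX_identical sigma0 hsigma_lim uf sf e4 eta0).
apply: with_high_probability_mono (with_high_probability_and h2 h3).
pose n2 := (Num.truncn (4 * A / e)).+1.
have An2 : 4 * A / e < n2%:R by exact: Num.Theory.truncnS_gt.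
(* From [n = 2] on the derivative has a zero, so its measure is not the default Dirac mass. *)
exists (maxn 2 (maxn n1 n2)) => n w; rewrite !geq_max => /and3P[n0 nn1 nn2] [].
have n00 : (0 < n)%N by exact: leq_trans n0.
have nR : (0 : R) < n%:R by rewrite ltr0n.
have nR1 : (0 : R) < n%:R - 1 by rewrite subr_gt0 ltr1n.
have sT := size_critical_points u X sigma w n00.
have -> : \int[zero_measure (poly_ n w)^`()]_z f z =
    (n%:R - 1)^-1 * \sum_(x <- critical_points u X sigma n w) f x.
  rewrite /zero_measure Rintegral_uniform_on; last exact: measurable_Cc_infty.
    rewrite polyE -/(critical_points u X sigma n w); congr (_^-1 * _).
    by rewrite [in RHS]sT -natr1 addrK.
  rewrite polyE -/(critical_points u X sigma n w) -size_eq0 -lt0n.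
  by rewrite -ltnS -sT.
have : `|\sum_(x <- critical_points u X sigma n w) f x| <= (n%:R - 1) * A.
  rewrite (le_trans (ler_norm_sum _ _ _))//.
  apply: (@le_trans _ _ (\sum_(x <- critical_points u X sigma n w) A)).
    exact: ler_sum.
  rewrite big_const_seq count_predT iter_addr_0 -[_ *+ _]mulr_natl.
  by rewrite [in leRHS]sT -natr1 addrK.
have := h1 n nn1; move: (\int[mu]_z f z) => I.
move: (\sum_(k < n) f (u k)) (\sum_(x <- critical_points _ _ _ _ _) f x) => U W.
move: (\sum_(x <- _) f x) => V hU hW hWV hVU.
(* The last term is the change of normalization, [1 / (n - 1) - 1 / n = 1 / (n (n - 1))]; it is at
   most [A / n] because [W] has [n - 1] terms bounded by [A]. *)
rewrite (_ : I - _ = (I - n%:R^-1 * U) - n%:R^-1 * (V - U) - n%:R^-1 * (W - V) -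
    (n%:R^-1 * ((n%:R - 1)^-1 * W))); last by field; rewrite !gt_eqF.
have nA : n%:R^-1 * A <= e / 4.
  rewrite ler_pdivrMl//.
  have : 4 * A <= n%:R * e.
    by rewrite -ler_pdivrMr// (le_trans (ltW An2))// ler_nat.
  lra.
have b1 : `|n%:R^-1 * (V - U)| <= e / 4.
  by rewrite normrM gtr0_norm ?invr_gt0// ler_pdivrMl// mulrC.
have b2 : `|n%:R^-1 * (W - V)| <= e / 4.
  by rewrite normrM gtr0_norm ?invr_gt0// ler_pdivrMl// mulrC.
have b3 : `|n%:R^-1 * ((n%:R - 1)^-1 * W)| <= e / 4.
  have i1 : 0 < n%:R^-1 :> R by rewrite invr_gt0.
  have i2 : 0 < (n%:R - 1)^-1 :> R by rewrite invr_gt0.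
  apply: le_trans nA; rewrite !normrM (gtr0_norm i1) (gtr0_norm i2).
  by rewrite ler_wpM2l ?invr_ge0// ler_pdivrMl.
rewrite (le_trans (ler_normB _ _))// (_ : e = e / 4 + e / 4 + e / 4 + e / 4); last by field.
rewrite lerD// (le_trans (ler_normB _ _))// lerD// (le_trans (ler_normB _ _))//.
by rewrite lerD.
Qed.
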